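(* Let $\mathcal{G}$ be a connected signed, colored graph of type $(n+1,n+1)$ satisfying axioms (ax1)–(ax5), such that each connected component of the $(n,n)$-restriction of $\mathcal{G}$ is isomorphic to a standard dual equivalence graph $\mathcal{G}_\mu$ for some partition $\mu$ of $n$. Then there exists a morphism from $\mathcal{G}$ to $\mathcal{G}_\lambda$ for a unique partition $\lambda$ of $n+1$.
   Context: Tableaux conventions. Partitions, French diagrams (cells $(i,j)$ with $1\le i\le\lambda_j$, rows from bottom). $\mathrm{SYT}(\lambda)$: bijections from cells to $[m]$, $m=|\lambda|$, increasing along rows and up columns. Content of $(i,j)$ is $i-j$; content reading word reads entries by increasing content, each diagonal southwest to northeast; descent signature $\sigma(T)\in\{\pm1\}^{m-1}$, $\sigma(T)_i=+1$ iff $i$ is left of $i+1$ in the reading word. $d_i$ on words: identity if $i$ lies positionally between $i-1,i+1$, otherwise swap $i$ with the farther of $i\pm1$; on tableaux, swap the corresponding entries. $\mathcal{G}_\lambda$: type $(m,m)$ graph on $\mathrm{SYT}(\lambda)$ with descent signatures and $E_i=\{\{T,d_i(T)\}:d_i(T)\ne T\}$, $1<i<m$. A signed, colored graph of type $(n,N)$ is $(V,\sigma,E)$: finite $V$, $\sigma:V\to\{\pm1\}^{N-1}$, for $1<i<n$ sets $E_i$ of $2$-element subsets of $V$. Its $(m,M)$-restriction ($m\le n$, $M\le N$) has vertices $V$, signatures truncated to the first $M-1$ coordinates, and edges $E_2,\dots,E_{m-1}$. Axioms (indices only where defined): (ax1) for $w\in V$, $1<i<n$: $\sigma(w)_{i-1}=-\sigma(w)_i$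 iff some $x$ has $\{w,x\}\in E_i$, and such $x$ is unique; (ax2) if $\{w,x\}\in E_i$: $\sigma(w)_j=-\sigma(x)_j$ for $j=i-1,i$ and $\sigma(w)_h=\sigma(x)_h$ for $h<i-2$, $h>i+1$; (ax3) if $\{w,x\}\in E_i$ and $\sigma(w)_{i-2}=-\sigma(x)_{i-2}$ then $\sigma(w)_{i-2}=-\sigma(w)_{i-1}$; if $\sigma(w)_{i+1}=-\sigma(x)_{i+1}$ then $\sigma(w)_{i+1}=-\sigma(w)_i$; (ax4) each component of $(V,E_{i-1}\cup E_i)$ is a single vertex, a path $x,y,z$ with only edges $\{x,y\}\in E_{i-1}$, $\{y,z\}\in E_i$, or two vertices joined by both an $E_{i-1}$- and an $E_i$-edge; each component of $(V,E_{i-2}\cup E_{i-1}\cup E_i)$ is: (a) a single vertex; (b) a path $p,q,r,s$ with only edges $\{p,q\}\in E_{i-2}$, $\{q,r\}\in E_{i-1}$, $\{r,s\}\in E_i$; (c) vertices $a,b,c,d,e$ with only edges $\{a,b\}\in E_{i-2}\cap E_{i-1}$, $\{b,c\}\in E_i$, $\{c,d\}\in E_{i-2}$, $\{d,e\}\in E_{i-1}\cap E_i$; (d) vertices $u,v,w,x,y,z$ with only edges $\{u,v\}\in E_{i-1}$, $\{v,w\}\in E_{i-2}$, $\{v,x\}\in E_i$, $\{w,y\}\in E_i$, $\{x,y\}\in E_{i-2}$, $\{y,z\}\in E_{i-1}$; (ax5) if $\{w,x\}\in E_i$, $\{x,y\}\in E_j$, $|i-j|\ge3$, then some $v$ has $\{w,v\}\in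 E_j$, $\{v,y\}\in E_i$. A morphism between signed colored graphs of type $(n,N)$ satisfying (ax1) is a vertex map $\phi$ with $\sigma(\phi(v))=\sigma(v)$ and $\{\phi(u),\phi(v)\}\in E_i$ whenever $\{u,v\}\in E_i$; an isomorphism is a bijective morphism. *)

(* Defs.v *)
From mathcomp Require Import all_boot.
Set Implicit Arguments. Unset Strict Implicit. Unset Printing Implicit Defensive.

(* ---------- Signs and signatures ----------
   A sign +1 is encoded by [true], -1 by [false]; a signature in {±1}^{N-1}
   is a [seq bool] of size N-1, whose coordinate k (1 <= k <= N-1) is [sg s k]. *)
Definition sg (s : seq bool) (k : nat) : bool := nth false s k.-1.

Definition upair (V : eqType) (a b x y : V) : bool :=
  ((a == x) && (b == y)) || ((a == y) && (b == x)).

(* ---------- Signed, colored graphs ----------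
   A signed colored graph of type (n,N) is given by a finite vertex type V,
   sigma : V -> seq bool, and E : nat -> rel V where, for 1 < i < n, E i is the
   (symmetric, irreflexive) relation "{u,v} \in E_i".  Values of E i for other
   i are irrelevant. *)
Definition scg (n N : nat) (V : finType) (sigma : V -> seq bool)
    (E : nat -> rel V) : Prop :=
  (forall v, size (sigma v) = N.-1) /\
  (forall i, 1 < i < n -> symmetric (E i) /\ irreflexive (E i)).

Definition runion (n : nat) (V : finType) (E : nat -> rel V) : rel V :=
  fun u v => [exists i : 'I_n, (1 < i) && E i u v].

Definition connected_scg (n : nat) (V : finType) (E : nat -> rel V) : Prop :=
  (exists v : V, True) /\ (forall u v : V, connect (runion n E) u v).

Definition ccomp (n : nat) (V : finType) (E : nat -> rel V) (v : V) : {set V} :=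
  [set x | connect (runion n E) v x].

Definition restr_sigma (M : nat) (V : Type) (sigma : V -> seq bool) :=
  fun v => take M.-1 (sigma v).
Definition restr_E (m : nat) (V : Type) (E : nat -> rel V) : nat -> rel V :=
  fun i u v => (1 < i < m) && E i u v.

Definition ax1 (n N : nat) (V : finType) (sigma : V -> seq bool)
    (E : nat -> rel V) : Prop :=
  forall w i, 1 < i < n -> i < N ->
    ((sg (sigma w) i.-1 = ~~ sg (sigma w) i) <-> exists x, E i w x) /\
    (forall x y, E i w x -> E i w y -> x = y).

Definition ax2 (n N : nat) (V : finType) (sigma : V -> seq bool)
    (E : nat -> rel V) : Prop :=
  forall w x i, 1 < i < n -> E i w x ->
    (forall j, (j == i.-1) || (j == i) -> j < N ->
        sg (sigma w) j = ~~ sg (sigma x) j) /\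
    (forall h, 0 < h < N -> (h + 2 < i) || (i.+1 < h) ->
        sg (sigma w) h = sg (sigma x) h).

Definition ax3 (n N : nat) (V : finType) (sigma : V -> seq bool)
    (E : nat -> rel V) : Prop :=
  forall w x i, 1 < i < n -> E i w x ->
    (2 < i -> i.-1 < N ->
       sg (sigma w) (i - 2) = ~~ sg (sigma x) (i - 2) ->
       sg (sigma w) (i - 2) = ~~ sg (sigma w) i.-1) /\
    (i.+1 < N ->
       sg (sigma w) i.+1 = ~~ sg (sigma x) i.+1 ->
       sg (sigma w) i.+1 = ~~ sg (sigma w) i).

Definition edges_are (V : finType) (R : rel V) (C : {set V}) (l : seq (V * V)) :=
  {in C &, forall a b, R a b = has (fun p => upair a b p.1 p.2) l}.

Definition ax4 (n N : nat) (V : finType) (sigma : V -> seq bool)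
    (E : nat -> rel V) : Prop :=
  (forall i, 2 < i < n -> forall v : V,
    let C := [set x | connect (fun a b => E i.-1 a b || E i a b) v x] in
    (exists x, C = [set:: [:: x]] /\
        edges_are (E i.-1) C [::] /\ edges_are (E i) C [::]) \/
    (exists x y z, uniq [:: x; y; z] /\ C = [set:: [:: x; y; z]] /\
        edges_are (E i.-1) C [:: (x, y)] /\ edges_are (E i) C [:: (y, z)]) \/
    (exists x y, uniq [:: x; y] /\ C = [set:: [:: x; y]] /\
        edges_are (E i.-1) C [:: (x, y)] /\ edges_are (E i) C [:: (x, y)])) /\
  (forall i, 3 < i < n -> forall v : V,
    let C := [set x | connect
                 (fun a b => [|| E (i - 2) a b, E i.-1 a b | E i a b]) v x] in
    (exists x, C = [set:: [:: x]] /\ edges_are (E (i - 2)) C [::] /\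
        edges_are (E i.-1) C [::] /\ edges_are (E i) C [::]) \/
    (exists p q r s, uniq [:: p; q; r; s] /\ C = [set:: [:: p; q; r; s]] /\
        edges_are (E (i - 2)) C [:: (p, q)] /\
        edges_are (E i.-1) C [:: (q, r)] /\ edges_are (E i) C [:: (r, s)]) \/
    (exists a b c d e, uniq [:: a; b; c; d; e] /\
        C = [set:: [:: a; b; c; d; e]] /\
        edges_are (E (i - 2)) C [:: (a, b); (c, d)] /\
        edges_are (E i.-1) C [:: (a, b); (d, e)] /\
        edges_are (E i) C [:: (b, c); (d, e)]) \/
    (exists u v' w x y z, uniq [:: u; v'; w; x; y; z] /\
        C = [set:: [:: u; v'; w; x; y; z]] /\
        edges_are (E (i - 2)) C [:: (v', w); (x, y)] /\
        edges_are (E i.-1) C [:: (u, v'); (y, z)] /\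
        edges_are (E i) C [:: (v', x); (w, y)])).

Definition ax5 (n N : nat) (V : finType) (sigma : V -> seq bool)
    (E : nat -> rel V) : Prop :=
  forall w x y i j, 1 < i < n -> 1 < j < n -> (i + 3 <= j) || (j + 3 <= i) ->
    E i w x -> E j x y -> exists v, E j w v /\ E i v y.

Definition scg_axioms (n N : nat) (V : finType) (sigma : V -> seq bool)
    (E : nat -> rel V) : Prop :=
  [/\ ax1 n N sigma E, ax2 n N sigma E, ax3 n N sigma E, ax4 n N sigma E
    & ax5 n N sigma E].

Definition morph_on (n : nat) (V W : finType) (C : {set V})
    (sV : V -> seq bool) (EV : nat -> rel V)
    (sW : W -> seq bool) (EW : nat -> rel W) (phi : V -> W) : Prop :=
  (forall v, v \in C -> sW (phi v) = sV v) /\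
  (forall i u v, 1 < i < n -> u \in C -> v \in C -> EV i u v ->
     EW i (phi u) (phi v)).

Definition iso_on (n : nat) (V W : finType) (C : {set V})
    (sV : V -> seq bool) (EV : nat -> rel V)
    (sW : W -> seq bool) (EW : nat -> rel W) (phi : V -> W) : Prop :=
  [/\ morph_on n C sV EV sW EW phi, {in C &, injective phi}
    & forall w, exists2 v, v \in C & phi v = w].

(* partition of m: nonincreasing sequence of positive integers summing to m;
   la = [:: la_1; la_2; ...] with la_j the length of row j (French, from bottom) *)
Definition is_partition (la : seq nat) (m : nat) : bool :=
  [&& sorted geq la, all (fun x => 0 < x) la & sumn la == m].

Definition cell (la : seq nat) (i j : nat) : bool :=
  [&& 0 < i, 0 < j & i <= nth 0 la j.-1].

Definition tab (la : seq nat) := {ffun 'I_(sumn la).+1 * 'I_(sumn la).+1 -> 'I_(sumn la).+1}.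

(* standard Young tableau: bijection from cells onto [m] = {1..m}, increasing
   along rows and up columns; non-cells are normalised to 0. *)
Definition syt_pred (la : seq nat) (T : tab la) : bool :=
  let Ix := ('I_(sumn la).+1 * 'I_(sumn la).+1)%type in
  [&& [forall c : Ix, ~~ cell la c.1 c.2 ==> (T c == ord0)],
      [forall c : Ix, cell la c.1 c.2 ==> (0 < T c)],
      [forall c : Ix, forall c' : Ix, [&& cell la c.1 c.2, cell la c'.1 c'.2 & T c == T c']
                 ==> (c == c')],
      [forall k : 'I_(sumn la).+1, (0 < k) ==>
                 [exists c : Ix, cell la c.1 c.2 && (T c == k)]],
      [forall c : Ix, forall c' : Ix, [&& cell la c.1 c.2, cell la c'.1 c'.2,
                               val c'.1 == (val c.1).+1 & val c'.2 == val c.2]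
                 ==> (T c < T c')]
    & [forall c : Ix, forall c' : Ix, [&& cell la c.1 c.2, cell la c'.1 c'.2,
                               val c'.1 == val c.1 & val c'.2 == (val c.2).+1]
                 ==> (T c < T c')]].

Definition SYT (la : seq nat) := {T : tab la | @syt_pred la T}.

Definition ent (la : seq nat) (T : tab la) (i j : nat) : nat :=
  val (T (inord i, inord j)).

(* content reading word: diagonals by increasing content i - j (diagonal
   d = i - j + K, K = |la|+1), each read southwest to northeast (increasing j). *)
Definition rw (la : seq nat) (T : tab la) : seq nat :=
  let K := (sumn la).+1 in
  flatten [seq [seq ent T p.1 p.2 |
                 p <- [seq (i, j) | j <- iota 1 K, i <- iota 1 K]
                 & cell la p.1 p.2 && (p.1 + K == d + p.2)]
          | d <- iota 0 (2 * K)].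

Definition pos (la : seq nat) (T : tab la) (k : nat) : nat := index k (rw T).

Definition sigma_syt (la : seq nat) (T : SYT la) : seq bool :=
  [seq pos (val T) k < pos (val T) k.+1 | k <- iota 1 (sumn la).-1].

Definition swap_ent (la : seq nat) (T : tab la) (a b : nat) : tab la :=
  [ffun c => if val (T c) == a then inord b
             else if val (T c) == b then inord a else T c].

Definition absd (p q : nat) : nat := (p - q) + (q - p).

Definition dual_d (la : seq nat) (i : nat) (T : tab la) : tab la :=
  let p := pos T i.-1 in let q := pos T i in let r := pos T i.+1 in
  if ((p < q) && (q < r)) || ((r < q) && (q < p)) then T
  else if absd q r < absd q p then swap_ent T i i.-1 else swap_ent T i i.+1.

Definition E_syt (la : seq nat) (i : nat) : rel (SYT la) :=
  fun T U => [&& 1 < i < sumn la, T != U &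
                 (val U == dual_d i (val T)) || (val T == dual_d i (val U))].

(* Main.v *)
Require Import Defs.
From mathcomp Require Import all_boot zify.
Set Implicit Arguments. Unset Strict Implicit. Unset Printing Implicit Defensive.

(** Listing the boxes of a standard tableau in the order of their entries turns
    the moves [d_i] into exchanges of neighbours in the list and the signature
    into comparisons of contents.  Everything rests on one fact: strictly
    between two addable boxes of a shape (in content) there is a removable box.
    With the connectedness of the dual equivalence classes it shows that a
    tableau is determined by the signatures met along all sequences of moves,
    and (with axiom 3) that on a component of the [(n,n)]-restriction the last
    sign is the one produced by putting [n+1] in one fixed addable box.  This
    attaches to every vertex [v] a standard tableau [psi v] of size [n+1],
    compatible with the edges of colour [< n].  For an [n]-edge [w x], axiom 5
    and rigidity make [psi w] and [psi x] agree on the entries [< n-1].  Moving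
    the remaining entries freely inside their shape, axiom 3 and the two-colour
    half of axiom 4 settle the case where [n-1] changes place, and the
    three-colour half forces the boxes of [n] and [n+1] to be exchanged
    otherwise.  So [psi] carries [n]-edges to [d_n], and its shape is constant. *)

(** * Boxes, contents and corners *)

(* A box is a pair (column, row), both counted from 0. *)
Notation box := (nat * nat)%type.

(* Contents [a.1 - a.2] and [b.1 - b.2] compared without truncated subtraction. *)
Definition clt (a b : box) : bool := a.1 + b.2 < b.1 + a.2.

Definition btw (a b c : box) : bool := (clt a b && clt b c) || (clt c b && clt b a).

(** The contents are pairwise distinct; [std_cmp3] gives this for three consecutive entries of a
    standard tableau. *)
Definition cmp3 (p q r : box) : bool :=
  [&& clt p q || clt q p, clt q r || clt r q & clt p r || clt r p].

(* The argument is symmetric under transposition of shapes, which reverses the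
   order of contents: [o] tells which of the two orders is meant. *)
Definition co (o : bool) (a b : box) : bool := if o then clt a b else clt b a.

(** The context is discarded, so every inequality used has to be moved into the goal first. *)
Ltac order := rewrite ?/co ?/cmp3 ?/btw /clt; clear; lia.

Definition addable (D : seq box) (a : box) : bool :=
  [&& a \notin D, (a.1 == 0) || ((a.1.-1, a.2) \in D)
    & (a.2 == 0) || ((a.1, a.2.-1) \in D)].

Definition removable (D : seq box) (c : box) : bool :=
  [&& c \in D, (c.1.+1, c.2) \notin D & (c.1, c.2.+1) \notin D].

Definition ideal (D : seq box) : Prop :=
  forall a b : box, b \in D -> a.1 <= b.1 -> a.2 <= b.2 -> a \in D.

Lemma eq_addable D D' : D =i D' -> addable D =1 addable D'.
Proof. by move=> h a; rewrite /addable !h. Qed.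

Lemma eq_removable D D' : D =i D' -> removable D =1 removable D'.
Proof. by move=> h a; rewrite /removable !h. Qed.

Lemma ideal_rcons D a : ideal D -> addable D a -> ideal (rcons D a).
Proof.
move=> I /and3P[_ h1 h2] [x y] b; rewrite !mem_rcons !inE => /orP[/eqP->|bD] /= lx ly;
  last by rewrite (I _ _ bD) ?orbT.
case: a h1 h2 lx ly => i j /= h1 h2 lx ly.
have [->|nx] := eqVneq x i; last first.
  have : (x, y) \in D by case/orP: h1 => [|h]; [lia | apply: (I _ _ h) => /=; lia].
  by move->; rewrite orbT.
have [->|ny] := eqVneq y j; first by rewrite eqxx.
have -> : (i, y) \in D by case/orP: h2 => [|h]; [lia | apply: (I _ _ h) => /=; lia].
by rewrite orbT.
Qed.

Section Ideal.
Variables (D : seq box).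
Hypothesis I : ideal D.

Lemma addable_below a b : addable D a -> b.1 < a.1 -> b.2 <= a.2 -> b \in D.
Proof.
by case/and3P=> _ h _ l1 l2; case/orP: h => [|h]; [lia | apply: (I h) => /=; lia].
Qed.

Lemma addable_left a b : addable D a -> b.1 <= a.1 -> b.2 < a.2 -> b \in D.
Proof.
by case/and3P=> _ _ h l1 l2; case/orP: h => [|h]; [lia | apply: (I h) => /=; lia].
Qed.

Lemma addable_antichain a b : addable D a -> addable D b -> clt a b ->
  (a.1 < b.1) && (b.2 < a.2).
Proof.
rewrite /clt => ha hb ab.
have na : a \notin D by case/and3P: ha.
have nb : b \notin D by case/and3P: hb.
case: (ltnP a.1 b.1) => h1; last by move: nb; rewrite (addable_left ha) //; lia.
case: (ltnP b.2 a.2) => h2 //; by move: na; rewrite (addable_below hb).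
Qed.

(** Of two distinct boxes on one diagonal one is strictly southwest of the other, hence already in
    [D] when the other is addable. *)
Lemma addable_inj a b : addable D a -> addable D b -> ~~ clt a b -> ~~ clt b a -> a = b.
Proof.
rewrite /clt => ha hb h1 h2.
have na : a \notin D by case/and3P: ha.
have nb : b \notin D by case/and3P: hb.
have [l|l|e] := ltngtP a.1 b.1.
- by move: na; rewrite (addable_below hb) //; lia.
- by move: nb; rewrite (addable_below ha) //; lia.
- by case: a b e h1 h2 {ha hb na nb} => [x y] [x' y'] /= -> h1 h2; congr pair; lia.
Qed.

Lemma addable_total a b : addable D a -> addable D b -> a != b -> clt a b || clt b a.
Proof.
move=> ha hb; apply: contraR; rewrite negb_or => /andP[h1 h2].
by apply/eqP; apply: addable_inj.
Qed.

(** Start just left of [b] and walk right or up inside [D]. Reaching the column of [b] or the row of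
    [a] would put [b] or [a] in [D], so the walk stops at a corner, which its column and row bounds
    place between the two. *)
Lemma removable_between a b : addable D a -> addable D b -> clt a b ->
  exists c : box, [/\ removable D c, clt a c & clt c b].
Proof.
move=> ha hb ab; have /andP[ab1 ab2] := addable_antichain ha hb ab.
have na : a \notin D by case/and3P: ha.
have nb : b \notin D by case/and3P: hb.
suff climb N : forall c : box, c \in D -> a.1 <= c.1 < b.1 -> b.2 <= c.2 < a.2 ->
    (b.1 + a.2) - (c.1 + c.2) <= N ->
    exists c : box, [/\ removable D c, clt a c & clt c b].
  apply: (climb _ (b.1.-1, b.2)) (leqnn _) => /=; try lia.
  by apply: (addable_below hb) => /=; lia.
elim: N => [|N IH] c cD c1 c2 le; first by lia.
case h1 : ((c.1.+1, c.2) \in D).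
  apply: (IH _ h1) => /=; try lia.
  case: (ltnP c.1.+1 b.1) => [|l]; first by lia.
  by move: nb; rewrite (I h1) //=; lia.
case h2 : ((c.1, c.2.+1) \in D).
  apply: (IH _ h2) => /=; try lia.
  case: (ltnP c.2.+1 a.2) => [|l]; first by lia.
  by move: na; rewrite (I h2) //=; lia.
by exists c; rewrite /removable /clt cD h1 h2; split=> //; lia.
Qed.

Lemma column_top i : exists h, (i, h) \notin D /\ forall j, j < h -> (i, j) \in D.
Proof.
have ex : exists h, (i, h) \notin D.
  exists (\max_(b <- D) b.2).+1; apply/negP => h.
  by have := @leq_bigmax_seq _ D xpredT (fun b : box => b.2) _ h isT; rewrite /= ltnn.
case: (ex_minnP ex) => h nh mh; exists h; split=> // j ljh.
by apply/negPn/negP => /mh; lia.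
Qed.

Lemma addable_leftmost : exists a, addable D a /\ forall c : box, c \in D -> clt a c.
Proof.
have [h [nh lh]] := column_top 0; exists (0, h); split.
  by rewrite /addable nh /=; case: h lh {nh} => //= h ->; rewrite ?orbT.
move=> c cD; rewrite /clt /=; case: (ltnP c.2 h) => [|l]; first by lia.
by move: nh; rewrite (I cD).
Qed.

(** Take the box on top of the column after that of [c0]: a corner of larger content lies in this
    column or further right, and strictly lower. *)
Lemma addable_next c0 : removable D c0 ->
  exists a, [/\ addable D a, clt c0 a & forall c : box, removable D c -> clt c0 c -> clt a c].
Proof.
case/and3P=> c0D n1 n2; have [h [nh lh]] := column_top c0.1.+1.
have hc : h <= c0.2 by rewrite leqNgt; apply: contra n1 => /lh.
exists (c0.1.+1, h); split; last 1 first.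
- move=> c /and3P[cD _ nc]; rewrite /clt /= => lt.
  case: (leqP c.1 c0.1) => l1; first by move: nc; rewrite (I c0D) //=; lia.
  case: (ltnP c.2 h) => [|l]; first by lia.
  by move: nh; rewrite (I cD).
- rewrite /addable nh /= (I c0D) //=; case: h lh {nh hc} => //= h lh.
  by rewrite lh.
- by rewrite /clt /=; lia.
Qed.
End Ideal.

(** * Standard tableaux as lists of boxes *)

(** [D] holds the boxes of the smaller entries, so each box is tested when its entry is inserted. *)
Fixpoint std_from (D t : seq box) : bool :=
  if t is a :: t' then addable D a && std_from (rcons D a) t' else true.

Definition std (t : seq box) : bool := std_from [::] t.

Lemma std_from_cat D s t : std_from D (s ++ t) = std_from D s && std_from (D ++ s) t.
Proof.
by elim: s D => [|a s IH] D /=; rewrite ?cats0 // IH cat_rcons andbA.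
Qed.

Lemma std_cat s t : std (s ++ t) = std s && std_from s t.
Proof. exact: std_from_cat. Qed.

Lemma std_rcons s a : std (rcons s a) = std s && addable s a.
Proof. by rewrite -cats1 std_cat /= andbT. Qed.

Lemma std_ideal t : std t -> ideal t.
Proof.
elim/last_ind: t => [|t a IH]; first by move=> _ a b.
by rewrite std_rcons => /andP[/IH I /(ideal_rcons I)].
Qed.

Lemma std_uniq t : std t -> uniq t.
Proof.
elim/last_ind: t => [|t a IH] //.
by rewrite std_rcons rcons_uniq => /andP[/IH -> /and3P[-> _ _]].
Qed.

Lemma std_take k t : std t -> std (take k t).
Proof. by rewrite -{1}(cat_take_drop k t) std_cat => /andP[]. Qed.

Lemma eq_size s t : std s -> std t -> s =i t -> size s = size t.
Proof. by move=> /std_uniq us /std_uniq ut e; apply/perm_size/uniq_perm. Qed.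

Lemma removable_last s c : std (rcons s c) -> removable (rcons s c) c.
Proof.
rewrite std_rcons => /andP[/std_ideal I /and3P[nc _ _]].
rewrite /removable !mem_rcons !inE eqxx /= !negb_or.
case: c nc => i j nc /=; rewrite !xpair_eqE !eqxx /= andbT !eqn_leq !ltnn /=.
by apply/andP; split; apply: contra nc => /I -> //=.
Qed.

Lemma eq_rcons_rem (t : seq box) c : uniq t -> c \in t -> rcons (rem c t) c =i t.
Proof.
move=> u ct x; rewrite mem_rcons inE mem_rem_uniq // inE.
by have [->|] := eqVneq x c.
Qed.

Lemma removable_addable t c : std t -> removable t c -> addable (rem c t) c.
Proof.
move=> st /and3P[ct _ _]; have u := std_uniq st; have I := std_ideal st.
rewrite /addable !mem_rem_uniq // !inE eqxx /=; case: c ct => i j ct /=.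
rewrite !xpair_eqE; apply/andP; split.
  by case: i ct => //= i /I -> //=; rewrite andbT; lia.
by case: j ct => //= j /I -> //=; rewrite andbT; lia.
Qed.

Lemma rem_rcons (t : seq box) a c : uniq (rcons t a) ->
  rem c (rcons t a) = if a == c then t else rcons (rem c t) a.
Proof.
move=> u; move: (u); rewrite rem_filter // rcons_uniq => /andP[na ut].
rewrite filter_rcons /= rem_filter //; case: (eqVneq a c) => [<-|_] //=.
by apply/all_filterP/allP => x xt /=; apply: contra na => /eqP <-.
Qed.

(** The corner may hold any entry: no box rests on it, so the later boxes stay addable without
    it. *)
Lemma std_rem t c : std t -> removable t c -> std (rem c t).
Proof.
elim/last_ind: t => [|t a IH] // st; rewrite rem_rcons ?std_uniq //.
have u := std_uniq st; move: st; rewrite std_rcons => /andP[st aa] rc.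
case: eqVneq => // nac; have [ct n1 n2] := and3P rc.
have ct' : c \in t by move: ct; rewrite mem_rcons inE eq_sym (negbTE nac).
have rc' : removable t c.
  by move: n1 n2; rewrite /removable ct' !mem_rcons !inE !negb_or => /andP[_ ->] /andP[_ ->].
rewrite std_rcons IH //=.
have ut := std_uniq st.
move: aa n1 n2; rewrite /addable !mem_rem_uniq // !inE !mem_rcons !inE => /and3P[na l1 l2].
rewrite (negbTE na) andbF /= !negb_or => /andP[n1 _] /andP[n2 _]; apply/andP; split.
- case: eqVneq l1 => //= c0 ->; rewrite andbT; apply: contra n1 => /eqP <- /=.
  by rewrite prednK ?lt0n // -surjective_pairing.
- case: eqVneq l2 => //= c0 ->; rewrite andbT; apply: contra n2 => /eqP <- /=.
  by rewrite prednK ?lt0n // -surjective_pairing.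
Qed.

Lemma removable_inj t c c' : std t -> removable t c -> removable t c' -> c != c' ->
  clt c c' || clt c' c.
Proof.
move=> /std_ideal I /and3P[ct n1 n2] /and3P[ct' n1' n2']; apply: contraR.
rewrite negb_or /clt => /andP[h1 h2].
have [l1|l1|e] := ltngtP c.1 c'.1.
- by move: n1; rewrite (I _ _ ct') //=; lia.
- by move: n1'; rewrite (I _ _ ct) //=; lia.
by rewrite -pair_eqE /= e eqxx /=; lia.
Qed.

(* The entry ending up third from the end is chosen strictly between the two
   corners, so that the two last entries may then be exchanged. *)
Lemma std_two_last t c c' : std t -> removable t c -> removable t c' -> c != c' ->
  exists s m, [/\ std (s ++ [:: m; c'; c]), s ++ [:: m; c'; c] =i t & btw c' m c].
Proof.
move=> st rc rc' ne; have u := std_uniq st.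
have [ct n1 n2] := and3P rc; have [ct' n1' n2'] := and3P rc'.
pose t1 := rem c t; have st1 : std t1 by apply: std_rem.
have u1 := std_uniq st1.
have rc1 : removable t1 c'.
  rewrite /removable /t1 !mem_rem_uniq // !inE (negbTE n1') (negbTE n2') !andbF ct'.
  by rewrite eq_sym ne.
pose t2 := rem c' t1; have st2 : std t2 by apply: std_rem.
have a2 : addable t2 c' by apply: removable_addable.
have a1 : addable t1 c by apply: removable_addable.
(* No box of [t] rests on the corner [c'], so [c] is addable even before [c'] is put back. *)
have a2c : addable t2 c.
  move: a1; rewrite /addable /t2 !(mem_rem_uniq _ (std_uniq st1)) !inE.
  case/and3P=> na l1 l2; rewrite (negbTE na) andbF /=; apply/andP; split.
  - case: eqVneq l1 => //= c0 ->; rewrite andbT; apply: contra n1' => /eqP e.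
    by rewrite -e /= prednK ?lt0n // -surjective_pairing.
  - case: eqVneq l2 => //= c0 ->; rewrite andbT; apply: contra n2' => /eqP e.
    by rewrite -e /= prednK ?lt0n // -surjective_pairing.
have I2 := std_ideal st2.
have [m [rm bm]] : exists m, removable t2 m /\ btw c' m c.
  have [lt|lt] := orP (addable_total I2 a2c a2 ne).
    have [m [? h1 h2]] := removable_between I2 a2c a2 lt.
    by exists m; rewrite /btw h1 h2 orbT.
  have [m [? h1 h2]] := removable_between I2 a2 a2c lt.
  by exists m; rewrite /btw h1 h2.
have mt : m \in t2 by case/and3P: rm.
have e2 := eq_rcons_rem (std_uniq st2) mt.
have e1 := eq_rcons_rem (std_uniq st1) (proj1 (andP rc1)).
have e0 := eq_rcons_rem u ct.
have E2 : rcons (rcons (rem m t2) m) c' =i t1.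
  by move=> x; rewrite -e1 mem_rcons inE e2 mem_rcons inE.
exists (rem m t2), m; split=> //.
- rewrite -cat_rcons -cat_rcons cats1 !std_rcons std_rem // removable_addable //=.
  by rewrite (eq_addable e2) a2 (eq_addable E2).
- by move=> x; rewrite -cat_rcons -cat_rcons cats1 mem_rcons inE E2 -e0 mem_rcons inE.
Qed.

(** * Moves on three consecutive entries *)

(** If [r] rested on [q], their contents would differ by one, leaving no room for [p] strictly
    between. *)
Lemma addable_skip s p q r : addable (rcons s q) r -> btw q p r -> addable s r.
Proof.
rewrite /addable !mem_rcons !inE !negb_or => /and3P[/andP[_ ->] l1 l2] b /=.
case: q r l1 l2 b => [i j] [x y]; rewrite /btw /clt /= !xpair_eqE => /orP l1 /orP l2 b.
apply/andP; split.
- case: l1 => [->//|]; case: x l2 b => //= x l2 b /orP[|->//] e; lia.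
- case: l2 => [->//|]; case: y b l1 => //= y b l1 /orP[|->//] e; lia.
Qed.

Lemma addable_rcons s q r : addable s r -> r != q -> addable (rcons s q) r.
Proof.
rewrite /addable !mem_rcons !inE !negb_or => /and3P[-> l1 l2] -> /=.
by case/orP: l1 => ->; case/orP: l2 => ->; rewrite ?orbT.
Qed.

Lemma addable_neq s q r : addable (rcons s q) r -> r != q.
Proof. by rewrite /addable mem_rcons inE negb_or => /andP[/andP[]]. Qed.

Lemma std_swap s p q r : std (s ++ [:: q; r]) -> btw q p r -> std (s ++ [:: r; q]).
Proof.
rewrite !std_cat /= !andbT => /and3P[-> aq ar] b /=.
by rewrite (addable_skip ar b) addable_rcons // eq_sym (addable_neq ar).
Qed.

(* On the boxes of three consecutive entries i-1, i, i+1: the entry farther from i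
   is i-1 exactly when i+1 lies between the two others in the reading order. *)
Definition tri (t : seq box) : seq box :=
  if t is p :: q :: r :: u then
    if btw p q r then t else if btw p r q then [:: q, p, r & u] else [:: p, r, q & u]
  else t.

(** Entry [i-1] is at position [i-2], so [tri] acts on the boxes of [i-1], [i], [i+1]; for
    [1 < i < size t] this is the move of colour [i]. *)
Definition dd (i : nat) (t : seq box) : seq box := take (i - 2) t ++ tri (drop (i - 2) t).

(* Entry k of the tableau t is the box at position k-1 of t. *)
Definition sgn (t : seq box) (i : nat) : bool := clt (nth (0, 0) t i.-1) (nth (0, 0) t i).

Lemma size_tri t : size (tri t) = size t.
Proof. by case: t => [|p [|q [|r u]]] //=; case: ifP => // _; case: ifP. Qed.

Lemma perm_tri t : perm_eq (tri t) t.
Proof.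
case: t => [|p [|q [|r u]]] //=; case: ifP => // _; case: ifP => _.
  by rewrite (perm_catCA [:: q] [:: p]) .
by rewrite perm_cons (perm_catCA [:: r] [:: q]).
Qed.

Lemma perm_dd i t : perm_eq (dd i t) t.
Proof. by rewrite /dd -{3}(cat_take_drop (i - 2) t) perm_cat2l perm_tri. Qed.

Lemma size_dd i t : size (dd i t) = size t.
Proof. exact: perm_size (perm_dd i t). Qed.

Lemma mem_dd i t : dd i t =i t.
Proof. exact: perm_mem (perm_dd i t). Qed.

Lemma tri_cat t u : 2 < size t -> tri (t ++ u) = tri t ++ u.
Proof. by case: t => [|p [|q [|r v]]] //= _; case: ifP => // _; case: ifP. Qed.

Lemma dd_cat i t u : 1 < i < size t -> dd i (t ++ u) = dd i t ++ u.
Proof.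
move=> h; rewrite /dd takel_cat; last lia.
rewrite drop_cat; case: ifP => h'; last by lia.
by rewrite tri_cat ?size_drop ?catA //; lia.
Qed.

Lemma dd_tri s u i : i = (size s).+2 -> dd i (s ++ u) = s ++ tri u.
Proof.
by move=> ->; rewrite /dd subSS subSS subn0 take_size_cat // drop_size_cat.
Qed.

Lemma sgn_cat t u i : i < size t -> sgn (t ++ u) i = sgn t i.
Proof. by move=> h; rewrite /sgn !nth_cat h; case: ifP => //; lia. Qed.

Lemma sgn_take k t i : i < k -> sgn (take k t) i = sgn t i.
Proof. by move=> h; rewrite /sgn !nth_take //; lia. Qed.

Lemma sgn_nth s p q u i : i = (size s).+1 -> sgn (s ++ p :: q :: u) i = clt p q.
Proof.
by move=> ->; rewrite /sgn /= !nth_cat ltnn ltnNge leqnSn /= subnn subSnn.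
Qed.

(** With equal contents [p] would be strictly southwest of [q], and the box above the corner [p]
    would lie in [D]. *)
Lemma removable_addable_total D p q : ideal D -> removable D p -> addable D q ->
  clt p q || clt q p.
Proof.
move=> I /and3P[pD _ n2] aq; have nq : q \notin D by case/and3P: aq.
apply: contraR n2; rewrite /clt => h; apply: (addable_below I aq) => /=.
  case: (ltnP p.1 q.1) => // l; move: nq; rewrite (I _ _ pD) //; lia.
case: (ltnP p.2 q.2) => // l; move: nq; rewrite (I _ _ pD) //; lia.
Qed.

Lemma clt_total2 s p q : std (s ++ [:: p; q]) -> clt p q || clt q p.
Proof.
rewrite -cat_rcons cats1 std_rcons => /andP[st aq].
exact: removable_addable_total (std_ideal st) (removable_last st) aq.
Qed.

(** If [p] and [r] were on one diagonal, the left and lower neighbours of [r] would both be added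
    after [p]; but [q] is the only box added in between. *)
Lemma clt_total3 s p q r : std (s ++ [:: p; q; r]) -> clt p r || clt r p.
Proof.
rewrite -cat_rcons -cat_rcons cats1 std_rcons => /andP[st ar].
have nr : r \notin rcons (rcons s p) q by case/and3P: ar.
have pD : p \in rcons (rcons s p) q by rewrite !(mem_rcons, inE) eqxx orbT.
have I := std_ideal st; rewrite /clt.
case: (ltnP (p.1 + r.2) (r.1 + p.2)) => // l1; case: (ltnP (r.1 + p.2) (p.1 + r.2)) => // l2.
have lt1 : p.1 < r.1 by case: (ltnP p.1 r.1) => // l; move: nr; rewrite (I _ _ pD) //; lia.
have /and3P[_] := ar; have np : p \notin s.
  by have := std_uniq st; rewrite !rcons_uniq => /and3P[].
have Is : ideal s by move: st; rewrite !std_rcons => /andP[/andP[/std_ideal]].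
have nb (b : box) : p.1 <= b.1 -> p.2 <= b.2 -> b != p ->
    b \in rcons (rcons s p) q -> b = q.
  move=> h1 h2 h3; rewrite !(mem_rcons, inE) (negbTE h3) /= => /orP[/eqP//|bs].
  by move: np; rewrite (Is _ _ bs).
case: eqP => [|_ /= h1]; first lia.
case: eqP => [|_ /= h2]; first lia.
have e1 : (r.1.-1, r.2) = q by apply: nb => //=;
  [lia|lia|apply/eqP => e; rewrite -e /= in lt1 l1 l2; lia].
have e2 : (r.1, r.2.-1) = q by apply: nb => //=;
  [lia|lia|apply/eqP => e; rewrite -e /= in lt1 l1 l2; lia].
by move: e2; rewrite -e1 => -[]; lia.
Qed.

Lemma std_cmp3 s p q r u : std (s ++ [:: p, q, r & u]) -> cmp3 p q r.
Proof.
have -> : s ++ [:: p, q, r & u] = ((s ++ [:: p; q]) ++ [:: r]) ++ u by rewrite -!catA.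
rewrite std_cat => /andP[st _]; move: (st); rewrite std_cat => /andP[/clt_total2 h _].
move: st; rewrite -catA => st; rewrite /cmp3 h (clt_total3 st).
by move: st; rewrite /= -cat_rcons => /clt_total2 ->.
Qed.

Lemma split3 i (t : seq box) : 1 < i < size t ->
  exists (s : seq box) p q r u, t = s ++ [:: p, q, r & u] /\ i = (size s).+2.
Proof.
move=> h; have e := cat_take_drop (i - 2) t.
have : size (drop (i - 2) t) = size t - (i - 2) by rewrite size_drop.
have es : size (take (i - 2) t) = i - 2 by rewrite size_takel //; lia.
move: e; case: (drop _ _) => [|p [|q [|r u]]] e; try by move=> /=; lia.
by move=> _; exists (take (i - 2) t), p, q, r, u; split; [rewrite e | lia].
Qed.

Lemma sgn3 s p q r u i : i = (size s).+2 ->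
  (sgn (s ++ [:: p, q, r & u]) i.-1 = clt p q) * (sgn (s ++ [:: p, q, r & u]) i = clt q r).
Proof.
move=> ->; split; first by rewrite sgn_nth.
by rewrite -cat_rcons sgn_nth ?size_rcons.
Qed.

Lemma dd_id i t : 1 < i < size t -> std t -> sgn t i.-1 = sgn t i -> dd i t = t.
Proof.
move=> /split3[s [p [q [r [u [-> ei]]]]]] /std_cmp3 c3.
rewrite !(sgn3 _ _ _ _ ei) (dd_tri _ ei) /= => e.
suff -> : btw p q r by [].
by move: c3 e; rewrite /cmp3 /btw /clt; lia.
Qed.

(** When the move is not the identity, the box of middle content stays and the other two are
    exchanged, so the same exchange is made again. *)
Lemma dd_invol i t : 1 < i < size t -> std t -> dd i (dd i t) = t.
Proof.
move=> /split3[s [p [q [r [u [-> ei]]]]]] /std_cmp3 c3.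
rewrite !(dd_tri _ ei) /=; congr (s ++ _).
case b1 : (btw p q r); rewrite /= ?b1 //.
case b2 : (btw p r q) => /=.
  case: ifP => b3; first by move: b1 b2 b3 c3; rewrite /cmp3 /btw /clt; lia.
  by case: ifP => // b4; move: b1 b2 b3 b4 c3; rewrite /cmp3 /btw /clt; lia.
rewrite b2; case: ifP => // b3.
by move: b1 b2 b3 c3; rewrite /cmp3 /btw /clt; lia.
Qed.

(** * Connectedness of a shape, and rigidity *)

(** Dual equivalence classes are connected, phrased as an induction principle. If the last boxes
    differ, pass through a tableau ending in [m; c'; c] with [m] between the corners, where the top
    move exchanges the last two boxes. *)
Lemma std_connect k (P : seq box -> Prop) : forall t t' : seq box,
    (forall (s : seq box) i, std s -> s =i t -> 1 < i < k -> P s -> P (dd i s)) ->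
  std t -> std t' -> size t = k -> t =i t' -> P t -> P t'.
Proof.
elim: k P => [|k IH] P t t' clP st st' sz e Pt.
  by move: sz e Pt; case: t {clP st} => // _; case: t' {st'} => // a l /(_ a); rewrite !inE eqxx.
(* tableaux with the same last box are related by moves of the other entries *)
have same u u' c : std (rcons u c) -> std (rcons u' c) -> rcons u c =i t ->
    rcons u' c =i t -> P (rcons u c) -> P (rcons u' c).
  move=> su su' eu eu'; have suu := std_uniq su; have suu' := std_uniq su'.
  have szu : size u = k by have := eq_size su st eu; rewrite size_rcons sz => -[].
  move: (su) (su'); rewrite !std_rcons => /andP[su1 au] /andP[su1' au'].
  have euu : u =i u'.
    move=> x; have := eu x; rewrite -eu' !mem_rcons !inE.
    have [->|] := eqVneq x c => //= _.
    by rewrite (negbTE (proj1 (andP au))) (negbTE (proj1 (andP au'))).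
  apply: (IH (fun s => P (rcons s c)) u u') => // s i ss es hi Ps.
  have : P (dd i (rcons s c)).
    apply: clP => //; last by lia.
      by rewrite std_rcons ss (eq_addable es).
    by move=> x; rewrite -eu !mem_rcons !inE es.
  by rewrite -cats1 dd_cat ?cats1 // (eq_size ss su1 es) szu.
case/lastP: t => [//|t c] in clP st sz e Pt same *.
case/lastP: t' => [|t' c'] in st' e *; first by have := e c; rewrite mem_rcons inE eqxx.
have [cc|ne] := eqVneq c c'; first by rewrite -cc in st' e *; apply: same Pt.
have rc := removable_last st.
have rc' : removable (rcons t c) c' by rewrite (eq_removable e) removable_last.
have [s [m [ss es b]]] := std_two_last st rc rc' ne.
have szs : (size s).+2 = k.
  by have := eq_size ss st es; rewrite sz size_cat /= addn3 => -[].
have P1 : P (s ++ [:: m; c'; c]).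
  move: ss es; rewrite -cat_rcons -cat_rcons cats1 => ss es.
  by apply: same Pt.
(* [m] has the middle content, so [tri] leaves it in place and exchanges [c'] and [c]. *)
have : P (dd k (s ++ [:: m; c'; c])) by apply: clP => //; lia.
rewrite (dd_tri _ (esym szs)) /=.
case: ifP => b1; first by move: b b1; rewrite /btw /clt; lia.
case: ifP => b2; first by move: b b2; rewrite /btw /clt; lia.
have ss' : std (s ++ [:: m; c; c']).
  by move: ss; rewrite -!(cat_rcons m) => ss'; apply: std_swap ss' b.
have es' : s ++ [:: m; c; c'] =i rcons t c.
  by move=> x; rewrite -es !mem_cat !inE; congr orb; congr orb; rewrite orbC.
move: ss' es'; rewrite -!(cat_rcons m) -!(cat_rcons c) !cats1 => ss' es' P2.
by apply: same P2.
Qed.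

(** The allowed moves fix the last entry, so by induction the tableaux agree below it. If the last
    boxes differed, both would be addable to one shape, and moving a corner between them to the
    preceding entry would make the last signs differ. *)
Lemma rigid (R : seq box -> seq box -> Prop) k : 
    (forall t t', R t t' -> [/\ std t, std t', size t = k & size t' = k]) ->
    (forall t t' j, R t t' -> 0 < j < k -> sgn t j = sgn t' j) ->
    (forall t t' i, R t t' -> 1 < i -> i.+1 < k -> R (dd i t) (dd i t')) ->
  forall t t', R t t' -> t = t'.
Proof.
elim: k R => [|k IH] R st sg cl t t' Rt.
  by have [_ _] := st _ _ Rt; case: t t' {Rt} => [|? ?] [|? ?].
pose R' s s' := exists c c', R (rcons s c) (rcons s' c').
have eqR s s' c c' : R (rcons s c) (rcons s' c') -> s = s'.
  move=> h; apply: (IH R'); last by exists c, c'.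
  - move=> u u' [d [d' /st]]; rewrite !size_rcons !std_rcons.
    by case=> /andP[-> _] /andP[-> _] [->] [->].
  - move=> u u' j [d [d' /[dup] /sg h1 /st]]; rewrite !size_rcons => -[_ _ [e] [e']] hj.
    have [lu lu'] : j < size u /\ j < size u' by lia.
    by have := h1 j; rewrite -!cats1 !sgn_cat //; apply; lia.
  - move=> u u' i [d [d' /[dup] /cl h1 /st]]; rewrite !size_rcons => -[_ _ [e] [e']] h2 h3.
    have [lu lu'] : 1 < i < size u /\ 1 < i < size u' by lia.
    by exists d, d'; have := h1 i h2; rewrite -!cats1 !dd_cat //; apply; lia.
have [st1 st2 sz1 sz2] := st _ _ Rt.
case/lastP: t => [//|t c] in Rt st1 sz1 *.
case/lastP: t' => [//|t' c'] in Rt st2 sz2 *.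
have tt := eqR _ _ _ _ Rt; rewrite -tt in Rt st2 *; congr rcons.
move: st1 st2; rewrite !std_rcons => /andP[{}st ac] /andP[_ ac'].
have I := std_ideal st; apply/eqP/negPn/negP => ne.
have [m [rm bm]] : exists m, removable t m /\ btw c m c'.
  have [lt|lt] := orP (addable_total I ac ac' ne).
    have [m [? h1 h2]] := removable_between I ac ac' lt.
    by exists m; rewrite /btw h1 h2.
  have [m [? h1 h2]] := removable_between I ac' ac lt.
  by exists m; rewrite /btw h1 h2 orbT.
have e := eq_rcons_rem (std_uniq st) (proj1 (andP rm)).
have szt : size t = k by move: sz1; rewrite size_rcons => -[].
have : R (rcons (rcons (rem m t) m) c) (rcons (rcons (rem m t) m) c').
  (* Both tableaux share their prefix, so each move acts on the two of them simultaneously. *)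
  apply: (std_connect (k := k) (P := fun s => R (rcons s c) (rcons s c'))) Rt => //.
  - move=> s i ss es hi /cl /(_ (proj1 (andP hi))).
    have szs := eq_size ss st es; rewrite szt in szs.
    by rewrite -!cats1 !dd_cat ?szs //; apply; lia.
  - by rewrite std_rcons std_rem ?removable_addable.
have es : size (rem m t) = k.-1 by rewrite size_rem ?szt //; case/andP: rm.
have k0 : 0 < k by rewrite -szt; case: (t) rm.
have ek : k = (size (rem m t)).+1 by rewrite es prednK.
move=> /(sg _ _ k); rewrite -!cats1 -!catA /= !sgn_nth // leqnn k0 => /(_ isT).
by move: bm; rewrite /btw /clt; lia.
Qed.

Lemma removable_btw o D a b : ideal D -> addable D a -> addable D b -> co o a b ->
  exists m, [/\ removable D m, co o a m & co o m b].
Proof.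
case: o => I ha hb ab; first exact: (removable_between I ha hb ab).
by have [m [? ? ?]] := removable_between I hb ha ab; exists m.
Qed.

(** * Components of two and three consecutive colours *)

Ltac inedges :=
  rewrite /= /upair ?orbF;
  repeat match goal with
  | |- is_true (_ || _) -> _ => case/orP
  | |- is_true (_ && _) -> _ => case/andP
  | |- is_true (_ == _) -> _ => move/eqP => ?
  | |- is_true false -> _ => done
  end.

Ltac inuniq :=
  rewrite /= !inE ?negb_or ?andbT;
  repeat match goal with
  | |- is_true (_ && _) -> _ => case/andP
  | |- is_true (_ != _) -> _ => move/eqP => ?
  end.

Ltac outedge := rewrite /= /upair ?eqxx ?orbT.

Section Top.
Variables (n : nat) (V : finType) (sigma : V -> seq bool) (E : nat -> rel V).
Hypothesis G : scg n.+1 n.+1 sigma E.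
Hypothesis A : scg_axioms n.+1 n.+1 sigma E.

Lemma E_sym i u v : 1 < i < n.+1 -> E i u v = E i v u.
Proof. by move=> hi; apply: (proj1 (proj2 G i hi)). Qed.

(** By axiom 4, [w] is the middle of a path or an end of a double edge; in the path both neighbours
    are endpoints. *)
Lemma two_colors w x u : 2 < n -> E n w x -> E n.-1 w u ->
  u = x \/ (forall y, ~~ E n.-1 x y) /\ (forall y, ~~ E n u y).
Proof.
move=> hn; case: A => _ _ _ [/(_ n) h _] _.
have /h{h} /(_ w) : 2 < n < n.+1 by rewrite hn /=.
set C := finset _ => h Ewx Ewu.
have clC a b : a \in C -> E n.-1 a b || E n a b -> b \in C.
  by rewrite !inE => ca eb; apply: connect_trans ca _; apply: connect1.
have wC : w \in C by rewrite inE connect0.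
have xC : x \in C by apply: (clC w) => //; rewrite Ewx orbT.
have uC : u \in C by apply: (clC w) => //; rewrite Ewu.
have noE R l a : edges_are R C l -> a \in C -> (forall b, R a b -> b \in C) ->
    (forall b, ~~ has (fun p => upair a b p.1 p.2) l) -> forall y, ~~ R a y.
  move=> el aC cl h' y; apply/negP => ay; have := h' y.
  by rewrite -el ?ay // cl.
case: h => [[z [_ [_ en]]]|[[a [b [c [un [_ [em en]]]]]]|[a [b [un [_ [em en]]]]]]].
- by move: Ewx; rewrite en.
- move: Ewx Ewu un; rewrite en // em //; inedges; inuniq; try congruence.
  right; split; [apply: (noE _ _ _ em) => // | apply: (noE _ _ _ en) => //].
  + by move=> d e; apply: clC xC _; rewrite e.
  + by move=> d; apply/negP => h; move: h; inedges; congruence.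
  + by move=> d e; apply: clC uC _; rewrite e orbT.
  + by move=> d; apply/negP => h; move: h; inedges; congruence.
- by left; move: Ewx Ewu un; rewrite en // em //; inedges; inuniq; congruence.
Qed.

(** Only types (c) and (d) of axiom 4 contain an [n]-edge with an [n-2]-edge at both ends. Type (d)
    closes a square; in type (c) the edge is [{b,c}], with [a] on no [n]-edge and [d] on the double
    edge [{d,e}]. *)
Lemma three_colors w x w' x' : 3 < n -> E n w x -> E (n - 2) w w' -> E (n - 2) x x' ->
  [\/ E n w' x',
      (forall y, ~~ E n w' y) /\ (exists e, E n.-1 x' e && E n x' e)
    | (forall y, ~~ E n x' y) /\ (exists e, E n.-1 w' e && E n w' e)].
Proof.
move=> hn; case: A => _ _ _ [_ /(_ n) h] _.
have /h{h} /(_ w) : 3 < n < n.+1 by rewrite hn /=.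
set C := finset _ => h Ewx Eww Exx.
have clC a b : a \in C -> [|| E (n - 2) a b, E n.-1 a b | E n a b] -> b \in C.
  by rewrite !inE => ca eb; apply: connect_trans ca _; apply: connect1.
have wC : w \in C by rewrite inE connect0.
have xC : x \in C by apply: (clC w) => //; rewrite Ewx !orbT.
have wC' : w' \in C by apply: (clC w) => //; rewrite Eww.
have xC' : x' \in C by apply: (clC x) => //; rewrite Exx.
have noE l a : edges_are (E n) C l -> a \in C ->
    (forall b, ~~ has (fun p => upair a b p.1 p.2) l) -> forall y, ~~ E n a y.
  move=> el aC h' y; apply/negP => ay; have := h' y.
  by rewrite -el ?ay // (clC a) // ay !orbT.
case: h => [[z [_ [_ [_ en]]]]|[[p [q [r [s [un [_ [el [em en]]]]]]]]|
  [[a [b [c [d [e [un [eC [el [em en]]]]]]]]]|[u [v [w0 [x0 [y [z [un [_ [el [em en]]]]]]]]]]]]].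
- by move: Ewx; rewrite en.
- move: Ewx Eww Exx un; rewrite en // !el //; inedges; inuniq; congruence.
- have dC : d \in C by rewrite eC !inE eqxx !orbT.
  have eC' : e \in C by rewrite eC !inE eqxx !orbT.
  move: Ewx Eww Exx un; rewrite en // !el //; inedges; inuniq; try congruence.
  + apply: Or32; split; first by apply: (noE _ _ en) => // g; apply/negP => h; move: h; inedges; congruence.
    by exists e; rewrite em ?en //; subst; outedge.
  + apply: Or33; split; first by apply: (noE _ _ en) => // g; apply/negP => h; move: h; inedges; congruence.
    by exists e; rewrite em ?en //; subst; outedge.
- move: Ewx Eww Exx un; rewrite en // !el //; inedges; inuniq; try congruence.
  all: by apply: Or31; rewrite en //; subst; outedge.
Qed.
End Top.

(** * Edges of the top colour *)

Section Local.
Variables (n : nat) (V : finType) (sigma : V -> seq bool) (E : nat -> rel V).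
Hypothesis G : scg n.+1 n.+1 sigma E.
Hypothesis A : scg_axioms n.+1 n.+1 sigma E.
Variable psi : V -> seq box.
Hypothesis psi_std : forall v, std (psi v).
Hypothesis psi_size : forall v, size (psi v) = n.+1.
Hypothesis psi_sgn : forall v i, 0 < i <= n -> sg (sigma v) i = sgn (psi v) i.
Hypothesis psi_dd : forall i u v, 1 < i < n -> E i u v -> psi v = dd i (psi u).

Let E_sym := E_sym G.

Lemma edge_exists i w : 1 < i < n.+1 ->
  sgn (psi w) i.-1 = ~~ sgn (psi w) i -> exists x, E i w x.
Proof.
move=> hi; case: A => /(_ w i hi) h _ _ _ _; rewrite -!psi_sgn; [|lia|lia].
by apply: (proj1 (proj1 (h _))); lia.
Qed.

Lemma edge_sgn i w x : 1 < i < n.+1 -> E i w x ->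
  sgn (psi w) i.-1 = ~~ sgn (psi w) i.
Proof.
move=> hi e; case: A => /(_ w i hi) h _ _ _ _; rewrite -!psi_sgn; [|lia|lia].
by apply: (proj2 (proj1 (h _))); [lia|exists x].
Qed.

Lemma edge_flip i w x : 1 < i < n.+1 -> E i w x ->
  (sgn (psi w) i.-1 = ~~ sgn (psi x) i.-1) /\ (sgn (psi w) i = ~~ sgn (psi x) i).
Proof.
move=> hi e; case: A => _ /(_ w x i hi e) [h _] _ _ _; rewrite -!psi_sgn; try lia.
by split; apply: h; lia.
Qed.

Lemma edge_same w x j : 0 < j -> j + 2 < n -> E n w x -> sgn (psi w) j = sgn (psi x) j.
Proof.
move=> h1 h2 e; have hn : 1 < n < n.+1 by lia.
case: A => _ /(_ w x n hn e) [_ h] _ _ _; rewrite -!psi_sgn; try lia.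
by apply: h; lia.
Qed.

Lemma edge_ax3 w x : 2 < n -> E n w x -> sgn (psi w) (n - 2) = ~~ sgn (psi x) (n - 2) ->
  sgn (psi w) (n - 2) = ~~ sgn (psi w) n.-1.
Proof.
move=> h2 e; have hn : 1 < n < n.+1 by lia.
by case: A => _ _ /(_ w x n hn e) [h _] _ _; rewrite -!psi_sgn; try lia; apply: h; lia.
Qed.

(** Axiom 5 transports the [n]-edge along the [i]-edge. *)
Lemma edge_far w x w' i : 1 < i -> i + 3 <= n -> E n w x -> E i w w' ->
  exists x', [/\ E n w' x', E i x x' & psi x' = dd i (psi x)].
Proof.
move=> h1 h2 e e'; case: A => _ _ _ _ /(_ w' w x i n) h.
have [v [ev vx]] : exists v, E n w' v /\ E i v x.
  by apply: h => //; try lia; rewrite E_sym //; lia.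
have vx' : E i x v by rewrite E_sym //; lia.
by exists v; split=> //; apply: psi_dd vx'; lia.
Qed.

(* By edge_tails_shape below the boxes listed in s can be permuted at will. *)
Definition edge_tails (s t t' : seq box) : Prop :=
  exists w x, [/\ E n w x, psi w = s ++ t & psi x = s ++ t'].

Lemma edge_tails_sym s t t' : 1 < n -> edge_tails s t t' -> edge_tails s t' t.
Proof. by move=> hn [w [x [e pw px]]]; exists x, w; rewrite E_sym //; lia. Qed.

(** Moves inside [s] have colour at most [n-3], so they act in parallel on both ends of the edge;
    connectedness of the shape then reaches [s']. *)
Lemma edge_tails_shape s s' t t' : size s <= n - 2 -> std s -> std s' -> s =i s' ->
  edge_tails s t t' -> edge_tails s' t t'.
Proof.
move=> sz st st' e ed0.
apply: (@std_connect _ (fun u => edge_tails u t t') s s' _ st st' (erefl _) e ed0) => u i su eu hi.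
move=> [w [x [ed pw px]]]; have szu := eq_size su st eu.
have hi' : 1 < i < size u by rewrite szu.
case: (eqVneq (sgn u i.-1) (sgn u i)) => h; first by rewrite dd_id //; exists w, x.
have [w' ew] : exists w', E i w w'.
  apply: edge_exists; first lia.
  by rewrite pw !sgn_cat; try lia; case: (sgn u i.-1) h; case: (sgn u i).
have [x' [ex _ px']] : exists x', [/\ E n w' x', E i x x' & psi x' = dd i (psi x)].
  by apply: edge_far ed ew; lia.
exists w', x'; split=> //; first by rewrite (psi_dd _ ew) ?pw ?dd_cat //; lia.
by rewrite px' px dd_cat.
Qed.

(** The truncations have equal signs by axiom 2 and move in parallel by axiom 5, so [rigid]
    applies. *)
Lemma edge_take w x : 1 < n -> E n w x -> take (n - 2) (psi w) = take (n - 2) (psi x).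
Proof.
move=> hn e.
pose R t t' := exists w x, [/\ E n w x, t = take (n - 2) (psi w) & t' = take (n - 2) (psi x)].
apply: (@rigid R (n - 2)); last by exists w, x.
- move=> t t' [u [v [_ -> ->]]].
  by split; rewrite ?std_take // size_takel // psi_size; lia.
- move=> t t' j [u [v [ed -> ->]]] hj; rewrite !sgn_take; try lia.
  by apply: edge_same => //; lia.
- move=> t t' i [u [v [ed -> ->]]] h1 h2.
  have dt y : dd i (take (n - 2) (psi y)) = take (n - 2) (dd i (psi y)).
    rewrite -{2}(cat_take_drop (n - 2) (psi y)) dd_cat.
      by rewrite take_size_cat // size_dd size_takel // psi_size; lia.
    by rewrite size_takel ?psi_size; lia.
  rewrite !dt; have hi y : 1 < i < size (psi y) by rewrite psi_size; lia.
  case: (eqVneq (sgn (psi u) i.-1) (sgn (psi u) i)) => h.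
    rewrite !dd_id //; last by rewrite -!(edge_same _ _ ed) //; lia.
    by exists u, v.
  have [u' eu] : exists u', E i u u'.
    by apply: edge_exists; [lia | case: (sgn _ i.-1) h; case: (sgn _ i)].
  have [v' [ev _ pv]] : exists v', [/\ E n u' v', E i v v' & psi v' = dd i (psi v)].
    by apply: edge_far ed eu; lia.
  by exists u', v'; rewrite pv (psi_dd _ eu) //; lia.
Qed.

(** * Boxes of the entries [n-1], [n], [n+1] across an [n]-edge *)

Section Signs.
Variables (s : seq box) (p q r p' q' r' : box).
Hypothesis sz : n = (size s).+2.
Hypothesis ed : edge_tails s [:: p; q; r] [:: p'; q'; r'].

Lemma edge_tails_std : std (s ++ [:: p; q; r]).
Proof. by case: ed => w [x [_ <- _]]. Qed.

Lemma edge_tails_cmp : cmp3 p q r.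
Proof. exact: std_cmp3 edge_tails_std. Qed.

Lemma edge_tails_ends : clt p q = ~~ clt q r.
Proof.
case: ed => w [x [e pw px]]; have := edge_sgn _ e.
by rewrite pw !(sgn3 _ _ _ _ sz); apply; lia.
Qed.

Lemma edge_tails_flip : (clt p q = ~~ clt p' q') /\ (clt q r = ~~ clt q' r').
Proof.
case: ed => w [x [e pw px]]; have := edge_flip _ e.
by rewrite pw px !(sgn3 _ _ _ _ sz); apply; lia.
Qed.

Lemma edge_tails_addable : [/\ std s, addable s p, addable (rcons s p) q &
  addable (rcons (rcons s p) q) r].
Proof. by move: edge_tails_std; rewrite std_cat /= andbT => /and4P[]. Qed.

End Signs.

(** The corner [m] is made the box of [n-2]. The implication between signs is axiom 3. The
    disjunction is [two_colors] for the [n-1]-neighbour [u] of [w]: either [u = x], or [x] has no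
    [n-1]-edge and [u] no [n]-edge, both read as equal consecutive signs. *)
Lemma edge_tails_corner s p q r p' q' r' m : n = (size s).+2 -> 
  edge_tails s [:: p; q; r] [:: p'; q'; r'] -> removable s m ->
  [/\ 2 < n, (clt m p = ~~ clt m p' -> clt m p = ~~ clt p q) &
      clt m p = ~~ clt p q ->
      [:: m; p'; q'; r'] = tri [:: m; p; q; r] \/
      clt m p' = clt p' q' /\ 
      (let t := tri [:: m; p; q; r] in
       clt (nth (0, 0) t 1) (nth (0, 0) t 2) = clt (nth (0, 0) t 2) (nth (0, 0) t 3))].
Proof.
move=> sz ed rm; have [st _ _ _] := edge_tails_addable ed; have ms : m \in s by case/and3P: rm.
have e := eq_rcons_rem (std_uniq st) ms.
have szm : (size s) = (size (rem m s)).+1 by rewrite size_rem // prednK //; case: (s) ms.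
have n2 : 2 < n by rewrite sz szm.
have n3 : 1 < n.-1 < n.+1 by move: n2; clear; lia.
have {ed} : edge_tails (rcons (rem m s) m) [:: p; q; r] [:: p'; q'; r'].
  apply: edge_tails_shape ed => //; first by lia.
  by rewrite std_rcons std_rem ?removable_addable.
set s0 := rem m s in szm *; case=> w [x [ew pw px]].
rewrite !cat_rcons in pw px.
have i0 : n.-1 = (size s0).+2 by lia.
have i1 : n - 2 = n.-1.-1 by lia.
have sw := sgn3 m p q [:: r] i0; have sx := sgn3 m p' q' [:: r'] i0.
split=> //; first by have := edge_ax3 n2 ew; rewrite pw px i1 !sw !sx.
move=> h; have [u eu] : exists u, E n.-1 w u.
  by apply: edge_exists; [lia | rewrite pw !sw].
have pu : psi u = s0 ++ tri [:: m; p; q; r].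
  by rewrite (psi_dd _ eu) ?pw ?dd_tri //; lia.
have n2' : 1 < n < n.+1 by lia.
case: (two_colors A n2 ew eu) => [ux|[nx nu]].
  left; rewrite ux px in pu; move/eqP: pu; rewrite eqseq_cat // => /andP[_ /eqP //].
right; split.
  have [//|ne] := eqVneq (clt m p') (clt p' q'); case: (@edge_exists n.-1 x).
  - by [].
  - by rewrite px !sx; case: (clt m p') ne; case: (clt p' q').
  - by move=> y ey; have := nx y; rewrite ey.
set t := tri _ => /=.
have [//|ne] := eqVneq (clt (nth (0, 0) t 1) (nth (0, 0) t 2)) (clt (nth (0, 0) t 2) (nth (0, 0) t 3)).
case: (@edge_exists n u).
- by apply/andP; split=> //; move: n2; clear; lia.
- rewrite pu -/t; move: ne; case: (t) (size_tri _ : size t = 4) => [|a [|b [|c [|d [|? ?]]]]] //= _.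
  have i2 : n = (size (rcons s0 a)).+2 by rewrite size_rcons; lia.
  by rewrite -cat_rcons !(sgn3 _ _ _ _ i2); case: (clt b c); case: (clt c d).
- by move=> y ey; have := nu y; rewrite ey.
Qed.

(** Otherwise a corner [m] lies between [p'] and [p]: the sign [n-2] changes along the edge while
    [m], [p], [q] are monotone, against axiom 3. *)
Lemma edge_tails_monotone s p q r p' q' r' o : n = (size s).+2 -> 
  edge_tails s [:: p; q; r] [:: p'; q'; r'] -> co o p q -> p != p' -> co o p p'.
Proof.
move=> sz ed pq pp; have [st ap _ _] := edge_tails_addable ed.
have n1 : 1 < n by lia.
have [_ ap' _ _] := edge_tails_addable (edge_tails_sym n1 ed); have I := std_ideal st.
have := addable_total I ap ap' pp.
case b : (co o p p') => // h; have {}h : co o p' p by move: b h; rewrite /co; case: (o); order.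
have [m [rm m1 m2]] := removable_btw I ap' ap h.
have [_ /[swap] _] := edge_tails_corner sz ed rm.
by move: m1 m2 pq; rewrite /co; case: (o); order.
Qed.

(** A corner [m] between [p] and [p'] gives [w] an [n-1]-edge. The flip of the sign [n-1] excludes
    the path, so the [n]-edge coincides with the move of colour [n-1], which exchanges [p] and
    [q]. *)
Lemma edge_tails_double s p q r p' q' r' : n = (size s).+2 -> 
  edge_tails s [:: p; q; r] [:: p'; q'; r'] -> p != p' ->
  [/\ p' = q, q' = p, r' = r & btw p r q].
Proof.
move=> sz ed pp; have [st ap _ _] := edge_tails_addable ed.
have n1 : 1 < n by lia.
have [_ ap' _ _] := edge_tails_addable (edge_tails_sym n1 ed); have I := std_ideal st.
have c := edge_tails_cmp ed; have c' := edge_tails_cmp (edge_tails_sym n1 ed).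
have es := edge_tails_ends sz ed.
have [f1 f2] := edge_tails_flip sz ed.
pose o := clt p q.
have pq : co o p q by move: c; rewrite /o /co; case: ifP; order.
have pp' := edge_tails_monotone sz ed pq pp.
have [m [rm m1 m2]] := removable_btw I ap ap' pp'.
have [_ _ h] := edge_tails_corner sz ed rm.
case: h; first by move: m1 m2 pq; rewrite /o /co; case: ifP; order.
  rewrite /=; case: ifP => b1; first by move=> [e]; rewrite e eqxx in pp.
  case: ifP => b2.
    by move=> [e]; move: m1; rewrite e /co; case: (o); order.
  move=> [e1 e2 e3]; split=> //; move: c es f1 f2; rewrite e1 e2 e3; order.
case=> h _; move: h m1 m2 pq c c' f1; rewrite /o /co; case: ifP; order.
Qed.

(** Otherwise [q] is addable to [s], and a corner between [p] and [q] yields an [n-1]-move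
    exchanging them. A double edge would displace [p]; in a path the neighbour would still have
    opposite last signs, hence a forbidden [n]-edge. *)
Lemma edge_tails_no_double s p q r q' r' : n = (size s).+2 -> 
  edge_tails s [:: p; q; r] [:: p; q'; r'] -> ~~ btw p r q.
Proof.
move=> sz ed; apply/negP => b; have [st ap aq _] := edge_tails_addable ed.
have I := std_ideal st; have aq' := addable_skip aq b.
have pq : co (clt p q) p q by move: b; rewrite /co; case: ifP; order.
have [m [rm m1 m2]] := removable_btw I ap aq' pq.
have [_ _ h] := edge_tails_corner sz ed rm.
case: h; first by move: b m1 m2; rewrite /co; case: ifP; order.
  rewrite /=; case: ifP => b1; first by move: m1 m2 b1; rewrite /co; case: ifP; order.
  case: ifP => b2; first by move: m1 m2 b2; rewrite /co; case: ifP; order.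
  by move=> [e _ _]; move: (addable_neq aq); rewrite e eqxx.
case=> _ /=; case: ifP => b1; first by move: m1 m2 b1; rewrite /co; case: ifP; order.
case: ifP => b2 /=; first by move: m1 m2 b2; rewrite /co; case: ifP; order.
by move: b; order.
Qed.

(** What remains is [p] between [q] and [r]; the flips put [q'] on the side of [r] and [r'] on the
    side of [q]. *)
Lemma edge_tails_single s p q r q' r' : n = (size s).+2 -> 
  edge_tails s [:: p; q; r] [:: p; q'; r'] ->
  exists o, [/\ co o r p, co o p q, co o q' p & co o p r'].
Proof.
move=> sz ed; have n1 : 1 < n by lia.
have c := edge_tails_cmp ed; have c' := edge_tails_cmp (edge_tails_sym n1 ed).
have es := edge_tails_ends sz ed.
have [f1 f2] := edge_tails_flip sz ed.
have b := edge_tails_no_double sz ed; have b' := edge_tails_no_double sz (edge_tails_sym n1 ed).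
exists (clt p q); move: b b' c c' es f1 f2; rewrite /co /cmp3 /btw /clt; clear.
by case: ifP => *; split; lia.
Qed.

(** Rearrange [s] so that [n-3], [n-2], [n-1] occupy [m], [p1], [p] with [m] in between. The move of
    colour [n-2] exchanges [p1] and [p] at both ends, and [three_colors] gives the three
    alternatives. *)
Lemma edge_tails_corner2 s p q r q' r' p1 : n = (size s).+2 -> 
  edge_tails s [:: p; q; r] [:: p; q'; r'] -> removable (rcons s p) p1 -> p1 != p ->
  [\/ exists o, [/\ co o r p1, co o p1 q, co o q' p1 & co o p1 r'],
      btw p1 q r /\ btw p1 r' q' | btw p1 q' r' /\ btw p1 r q].
Proof.
move=> sz ed rp1 ne; have [st ap aq _] := edge_tails_addable ed.
have stp : std (rcons s p) by rewrite std_rcons st.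
have rp := removable_last stp; rewrite eq_sym in ne.
have [s3 [m [st3 e3 b3]]] := std_two_last stp rp rp1 ne.
have szs : size s = (size s3).+2.
  by have := eq_size st3 stp e3; rewrite size_cat size_rcons /= addn3 => -[].
have n3 : 3 < n by rewrite sz szs.
have i0 : n - 2 = (size s3).+2 by rewrite sz szs.
have i1 : n = (size (s3 ++ [:: m; p])).+2 by rewrite sz szs size_cat /= addn2.
have i2 : n.-1 = (size (rcons s3 m)).+2 by rewrite sz szs size_rcons.
have [n1 h0 h1 h1'] : [/\ 1 < n, 1 < n - 2 < n, 1 < n.-1 < n & size s <= n - 2].
  by move: n3 sz; clear; split; lia.
have h0' : 1 < n - 2 < n.+1 by move: h0; clear; lia.
have st4 : std (s3 ++ [:: m; p1]).
  by move: st3; rewrite -[[:: m; p1; p]]/([:: m; p1] ++ [:: p]) catA std_cat => /andP[].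
have es : s =i s3 ++ [:: m; p1].
  have := std_uniq stp; have := std_uniq st3.
  rewrite -[[:: m; p1; p]]/([:: m; p1] ++ [:: p]) catA cats1 !rcons_uniq.
  move=> /andP[n4 _] /andP[n5 _] y; have := e3 y.
  rewrite -[[:: m; p1; p]]/([:: m; p1] ++ [:: p]) catA cats1 !mem_rcons !in_cons.
  by case: eqVneq => [->|_] //=; rewrite (negbTE n4) (negbTE n5).
have {ed} : edge_tails (s3 ++ [:: m; p1]) [:: p; q; r] [:: p; q'; r'].
  exact: edge_tails_shape h1' st st4 es ed.
case=> w [x [ew]]; rewrite -!catA /= => pw px.
have sw u := sgn3 m p1 p u i0.
have nb v u : psi v = s3 ++ [:: m, p1, p & u] ->
    exists v', E (n - 2) v v' /\ psi v' = s3 ++ [:: m, p, p1 & u].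
  move=> pv; have [v' ev] : exists v', E (n - 2) v v'.
    apply: edge_exists => //; by rewrite pv !sw; move: b3; order.
  exists v'; split=> //; rewrite (psi_dd h0 ev) pv (dd_tri _ i0) /=.
  case: ifP => h; first by move: b3 h; order.
  by case: ifP => // h'; move: b3 h'; order.
have [w' [eww pw']] := nb _ _ pw; have [x' [exx px']] := nb _ _ px.
have cat4 u : s3 ++ [:: m, p & u] = (s3 ++ [:: m; p]) ++ u by rewrite -catA.
rewrite cat4 in pw'; rewrite cat4 in px'.
have stw := psi_std w'; have stx := psi_std x'; rewrite pw' in stw; rewrite px' in stx.
have no v a b c : psi v = (s3 ++ [:: m; p]) ++ [:: a; b; c] -> cmp3 a b c ->
    (forall y, ~~ E n v y) -> btw a b c.
  move=> pv c3 nv; apply/negPn/negP => h; case: (@edge_exists n v); first by rewrite n1 /=.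
    by rewrite pv !(sgn3 _ _ _ _ i1); move: c3 h; order.
  by move=> y ey; have := nv y; rewrite ey.
(* Here the [n-1]-move is also an [n]-edge. By [edge_take] it fixes [p], so it exchanges [a] and
   [b], and the flip of the last sign puts [c] between them. *)
have dbl v a b c : psi v = (s3 ++ [:: m; p]) ++ [:: a; b; c] -> cmp3 a b c ->
    a != p -> (exists e, E n.-1 v e && E n v e) -> btw a c b.
  move=> pv c3 ap' [e /andP[e1 e2]].
  have pe : psi e = s3 ++ m :: tri [:: p; a; b; c].
    by rewrite (psi_dd h1 e1) pv -!catA /= -cat_rcons (dd_tri _ i2) cat_rcons.
  have := edge_take n1 e2; rewrite pv pe i1 !subSS subn0 take_size_cat //.
  have n1' : 1 < n < n.+1 by rewrite n1 /=.
  have [_ ] := edge_flip n1' e2; rewrite pv pe.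
  rewrite (sgn3 _ _ _ _ i1) /=; case: ifP => b1.
    by rewrite cat4 (sgn3 _ _ _ _ i1) => /esym; case: clt.
  case: ifP => b2.
    move=> _ /eqP; rewrite size_cat /= take_cat ltnNge leq_addr /= addnC addnK /=.
    by rewrite eqseq_cat // eqxx /= => /eqP[pa]; rewrite pa eqxx in ap'.
  rewrite cat4 (sgn3 _ _ _ _ i1) => fl _; move: fl c3; order.
have c1 := std_cmp3 stw; have c2 := std_cmp3 stx; rewrite eq_sym in ne.
case: (three_colors A n3 ew eww exx) => [e|[nw dx]|[nx dw]].
- by apply: Or31; apply: edge_tails_single i1 _; exists w', x'.
- by apply: Or32; split; [apply: no pw' _ nw | apply: dbl px' _ _ dx].
- by apply: Or33; split; [apply: no px' _ nx | apply: dbl pw' _ _ dw].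
Qed.

(** Both [r] and [q'] are addable to [rcons s p], on the same side of [p]. If they differed, a
    corner [p1] between them would contradict each alternative of [edge_tails_corner2]. *)
Lemma edge_tails_swap s p q r q' r' : n = (size s).+2 -> 
  edge_tails s [:: p; q; r] [:: p; q'; r'] -> q' = r.
Proof.
move=> sz ed; have n1 : 1 < n by lia.
have [st ap aq ar] := edge_tails_addable ed; have [_ _ aq' _] := edge_tails_addable (edge_tails_sym n1 ed).
have [o [rp pq q'p pr']] := edge_tails_single sz ed.
have stp : std (rcons s p) by rewrite std_rcons st.
have I := std_ideal stp.
have ar' : addable (rcons s p) r.
  by apply: (addable_skip (p := p) ar); move: rp pq; rewrite /co; case: (o); order.
apply/eqP/negPn/negP => ne.
have [p1 [rp1 lt]] : exists p1, removable (rcons s p) p1 /\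
    (co o r p1 && co o p1 q' \/ co o q' p1 && co o p1 r).
  have := addable_total I aq' ar' ne; case: (boolP (co o r q')) => h.
    have [m [? h1 h2]] := removable_btw I ar' aq' h.
    by exists m; split=> //; left; rewrite h1.
  move=> h'; have {}h : co o q' r by move: h h'; rewrite /co; case: (o); order.
  have [m [? h1 h2]] := removable_btw I aq' ar' h.
  by exists m; split=> //; right; rewrite h1.
have p1p : p1 != p.
  by apply/eqP => e; rewrite e in lt; move: lt rp q'p; rewrite /co; case: (o); order.
case: (edge_tails_corner2 sz ed rp1 p1p).
- by case=> o'; case; move: lt rp pq q'p pr'; rewrite /co; case: (o); case: (o'); order.
- by case; move: lt rp pq q'p pr'; rewrite /co; case: (o); order.
- by case; move: lt rp pq q'p pr'; rewrite /co; case: (o); order.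
Qed.

Lemma edge_dd w x : 1 < n -> E n w x -> psi x = dd n (psi w).
Proof.
move=> n1 e; have n1' : 1 < n < size (psi w) by rewrite psi_size; lia.
have n2' : 1 < n < size (psi x) by rewrite psi_size; lia.
have [s [p [q [r [u [pw sz]]]]]] := split3 n1'.
have [s' [p' [q' [r' [u' [px sz']]]]]] := split3 n2'.
have u0 : u = [::].
  by have := psi_size w; rewrite pw size_cat /=; case: u {pw} => //= a u; lia.
have u0' : u' = [::].
  by have := psi_size x; rewrite px size_cat /=; case: u' {px} => //= a u'; lia.
have ss : s' = s.
  have := edge_take n1 e; rewrite pw px sz !subSS subn0 take_size_cat //.
  by rewrite take_size_cat //; lia.
rewrite {}u0 {}u0' {}ss in pw px *.
have ed : edge_tails s [:: p; q; r] [:: p'; q'; r'] by exists w, x.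
rewrite px pw dd_tri //=; congr (s ++ _).
have es := edge_tails_ends sz ed.
have nb : btw p q r = false by move: es; order.
rewrite nb; have [pp|pp] := eqVneq p p'; last first.
  by have [-> -> -> ->] := edge_tails_double sz ed pp.
rewrite -pp in ed *; rewrite (negbTE (edge_tails_no_double sz ed)).
(* The reversed edge supplies the remaining equality, [q = r']. *)
by rewrite (edge_tails_swap sz ed) (edge_tails_swap sz (edge_tails_sym n1 ed)).
Qed.

End Local.

(** * Extending a labelling by one box *)

Section Extend.
Variables (n : nat) (V : finType) (sigma : V -> seq bool) (E : nat -> rel V).
Hypothesis A : scg_axioms n.+1 n.+1 sigma E.
Variables (C : {set V}) (theta : V -> seq box).
Hypothesis C_closed : forall i u v, 1 < i < n -> u \in C -> E i u v -> v \in C.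
Hypothesis th_std : forall u, u \in C -> std (theta u).
Hypothesis th_size : forall u, u \in C -> size (theta u) = n.
Hypothesis th_sgn : forall u i, u \in C -> 0 < i < n -> sg (sigma u) i = sgn (theta u) i.
Hypothesis th_dd : forall i u v, 1 < i < n -> u \in C -> E i u v -> theta v = dd i (theta u).
Hypothesis th_inj : {in C &, injective theta}.
Hypothesis th_shape : forall u v, u \in C -> v \in C -> theta u =i theta v.

Lemma comp_edge i u : 1 < i < n -> u \in C -> sgn (theta u) i.-1 = ~~ sgn (theta u) i ->
  exists v, E i u v.
Proof.
move=> hi uC; have [h1 h2 h3 h4] : [/\ 1 < i < n.+1, i < n.+1, 0 < i < n & 0 < i.-1 < n].
  by move: hi; clear; split; lia.
by case: A => /(_ u i h1 h2) [[h _] _] _ _ _ _; rewrite -!th_sgn.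
Qed.

(** The colours [i] used satisfy [i+1 < n], so axiom 2 preserves the sign [n]. *)
Lemma comp_walk s s' t u : u \in C -> theta u = s ++ t -> size s < n -> std s' -> s =i s' ->
  exists v, [/\ v \in C, theta v = s' ++ t & sg (sigma v) n = sg (sigma u) n].
Proof.
move=> uC tu sz st' e; have st : std s by have := th_std uC; rewrite tu std_cat => /andP[].
apply: (@std_connect _ (fun x => exists v, [/\ v \in C, theta v = x ++ t &
  sg (sigma v) n = sg (sigma u) n]) s s' _ st st' (erefl _) e); last by exists u.
move=> x i sx ex hi [v [vC tv sv]]; have szx := eq_size sx st ex.
have hi' : 1 < i < size x by rewrite szx.
case: (eqVneq (sgn x i.-1) (sgn x i)) => h; first by rewrite dd_id //; exists v.
have [hin h1 h2 h3] : [/\ 1 < i < n, i.-1 < size x, i < size x & i.+1 < n].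
  by move: hi sz szx; clear; split; lia.
have [w ew] : exists w, E i v w.
  by apply: comp_edge => //; rewrite tv !sgn_cat //; case: (sgn x i.-1) h; case: (sgn x i).
exists w; split; first exact: C_closed ew.
  by rewrite (th_dd hin vC ew) tv dd_cat.
rewrite -sv; have [h4 h5] : 1 < i < n.+1 /\ 0 < n < n.+1 by move: hin; clear; lia.
by case: A => _ /(_ v w i h4 ew) [_ ->] //; rewrite h3 orbT.
Qed.

(** Equal last boxes are joined by a walk preserving the sign [n]. If [c] preceded [c'], some
    [n-1]-edge would exchange [c'] and [c] in the last two places while changing the sign [n], and
    axiom 3 would force the opposite order. *)
Lemma last_sign_monotone u u' s s' c c' : u \in C -> u' \in C ->
  theta u = rcons s c -> theta u' = rcons s' c' ->
  sg (sigma u) n = false -> sg (sigma u') n = true -> clt c' c.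
Proof.
move=> uC uC' tu tu' su su'.
have st := th_std uC; have st' := th_std uC'; have e := th_shape uC uC'.
have szu := th_size uC; have szu' := th_size uC'.
rewrite tu in st e szu; rewrite tu' in st' e szu'; rewrite size_rcons in szu szu'.
have szn : size s < n by rewrite -szu.
have cancel x x' d : uniq (rcons x d) -> uniq (rcons x' d) -> rcons x d =i rcons x' d -> x =i x'.
  rewrite !rcons_uniq => /andP[n1 _] /andP[n2 _] ex y; have := ex y.
  by rewrite !mem_rcons !in_cons; case: eqVneq => [->|_] //=; rewrite (negbTE n1) (negbTE n2).
have [cc|ne] := eqVneq c c'.
  rewrite -cc in tu' st' e.
  have es : s =i s' by apply: cancel e; apply: std_uniq.
  have ss' : std s' by move: st'; rewrite std_rcons => /andP[].
  have tu1 : theta u = s ++ [:: c] by rewrite tu cats1.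
  have [v [vC tv sv]] := comp_walk uC tu1 szn ss' es.
  have vu : v = u' by apply: th_inj => //; rewrite tv tu' cats1.
  by move: sv; rewrite vu su su'.
have rc := removable_last st.
have rc' : removable (rcons s c) c' by rewrite (eq_removable e) removable_last.
have /orP[lt|//] := removable_inj st rc rc' ne.
have [s3 [m [st3 e3 b3]]] := std_two_last st rc rc' ne.
have [mc mc'] : clt c m /\ clt m c' by move: b3 lt; order.
have sz3 : n = (size s3).+3.
  by have := eq_size st3 st e3; rewrite size_cat size_rcons /= szu addn3 => <-.
have i0 : n.-1 = (size s3).+2 by rewrite sz3.
have n2 : 1 < n.-1 < n by rewrite i0 sz3 /=.
have st3' : std (s3 ++ [:: m; c; c']).
  by move: st3; rewrite -!(cat_rcons m) => h; apply: std_swap h b3.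
have dec x y : s3 ++ [:: m; x; y] = rcons (s3 ++ [:: m; x]) y.
  by rewrite -cats1 -catA.
have [u1 [u1C tu1 su1]] : exists v, [/\ v \in C, theta v = s3 ++ [:: m; c'; c] &
    sg (sigma v) n = false].
  rewrite dec in st3 e3 *; rewrite -su -cats1.
  have tu1 : theta u = s ++ [:: c] by rewrite tu cats1.
  apply: comp_walk uC tu1 szn _ _.
    by move: st3; rewrite std_rcons => /andP[].
  by move=> y; apply: cancel (std_uniq st) (std_uniq st3) _ y => y; rewrite e3.
have [u2 eu] : exists v, E n.-1 u1 v.
  by apply: comp_edge => //; rewrite tu1 !(sgn3 _ _ _ _ i0); move: lt mc'; order.
have u2C := C_closed n2 u1C eu.
have tu2 : theta u2 = (s3 ++ [:: m; c]) ++ [:: c'].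
  rewrite (th_dd n2 u1C eu) tu1 (dd_tri _ i0) -catA /=.
  case: ifP => h; first by move: lt mc mc' h; order.
  by case: ifP => // h'; move: lt mc mc' h'; order.
have su2 : sg (sigma u2) n = true.
  have ss' : std s' by move: st'; rewrite std_rcons => /andP[].
  have [||v [vC tv sv]] := comp_walk u2C tu2 _ ss'.
  - by rewrite size_cat /= sz3 addn2.
  - rewrite cats1 in tu2; apply: cancel (_ : uniq (rcons _ c')) (std_uniq st') _.
      by rewrite -tu2 std_uniq ?th_std.
    by rewrite -tu2 -tu'; apply: th_shape.
  have vu : v = u' by apply: th_inj => //; rewrite tv tu' cats1.
  by rewrite -sv vu.
have [n0 n1 n3] : [/\ 0 < n, 1 < n.-1 < n.+1 & 0 < n.-1 < n] by move: n2; clear; split; lia.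
case: A => _ _ /(_ u1 u2 n.-1 n1 eu) [_ h] _ _.
have := h; rewrite prednK // su1 su2 th_sgn // tu1 !(sgn3 _ _ _ _ i0) => /(_ (ltnSn n) erefl).
by move: lt; order.
Qed.

(** By monotonicity a threshold separates last boxes of sign +1 from those of sign -1: take the
    addable box following the last positive one, or the leftmost if there is none. *)
Lemma last_sign_addable v : v \in C ->
  exists a, forall u, u \in C -> addable (theta u) a /\
    (0 < n -> sg (sigma u) n = clt (nth (0, 0) (theta u) n.-1) a).
Proof.
move=> vC.
have [n0|n0] := posnP n.
  have [a [aa _]] := addable_leftmost (std_ideal (th_std vC)).
  by exists a => u uC; rewrite (eq_addable (th_shape uC vC)) n0.
have lastE u : u \in C -> exists s, theta u = rcons s (nth (0, 0) (theta u) n.-1).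
  move=> uC; have := th_size uC; case/lastP: (theta u) => [|s c] sz; first by move: n0; rewrite -sz.
  by exists s; rewrite -sz size_rcons nth_rcons ltnn eqxx.
pose lst u := nth (0, 0) (theta u) n.-1.
have lastR u w : u \in C -> w \in C -> removable (theta w) (lst u).
  move=> uC wC; rewrite -(eq_removable (th_shape uC wC)); have [s e] := lastE _ uC.
  by have := th_std uC; rewrite e -/(lst u) => /removable_last; rewrite -e.
case: (pickP [pred u in C | sg (sigma u) n]) => [u1 /= P1|none]; last first.
  have [a [aa lt]] := addable_leftmost (std_ideal (th_std vC)).
  exists a => u uC; rewrite (eq_addable (th_shape uC vC)); split=> // _.
  have := none u; rewrite /= uC /= => ->.
  have /and3P[/lt h _ _] := lastR _ _ uC vC.
  by apply/esym/negbTE; move: h; rewrite /lst; order.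
(* Shifting by [M] keeps contents in the natural numbers, where a maximum can be taken. *)
pose M := \max_u (lst u).2.
have leM u : (lst u).2 <= M by apply: leq_bigmax.
pose f u := (lst u).1 + (M - (lst u).2).
case: (@arg_maxnP _ u1 [pred u in C | sg (sigma u) n] f P1) => u0 /= /andP[u0C s0] mx.
have [a [aa lt0 lta]] := addable_next (std_ideal (th_std u0C)) (lastR _ _ u0C u0C).
exists a => u uC; rewrite (eq_addable (th_shape uC u0C)); split=> // _.
have [s e] := lastE _ uC; have [s' e'] := lastE _ u0C.
case su : (sg (sigma u) n).
  have /mx : (u \in C) && sg (sigma u) n by rewrite uC su.
  move: lt0 (leM u) (leM u0); rewrite /f -/(lst u); order.
have lt : clt (lst u0) (lst u) := last_sign_monotone uC u0C e e' su s0.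
have := lta _ (lastR _ _ uC u0C) lt.
by move=> h; apply/esym/negbTE; move: h; rewrite /lst /clt; lia.
Qed.

End Extend.

(** * Tableaux of a fixed shape *)

Definition of_shape (la : seq nat) (t : seq box) : Prop :=
  forall c : box, (c \in t) = (c.1 < nth 0 la c.2).

Definition boxes (la : seq nat) : seq box :=
  [seq (i, j) | j <- iota 0 (size la), i <- iota 0 (nth 0 la j)].

Lemma mem_boxes la : of_shape la (boxes la).
Proof.
case=> i j /=; apply/allpairsPdep/idP => [[y [x []]]|h].
  by rewrite !mem_iota => _ h [-> ->].
exists j, i; rewrite !mem_iota /=; split=> //.
by case: (ltnP j (size la)) => // l; rewrite nth_default in h.
Qed.

Lemma boxes_uniq la : uniq (boxes la).
Proof.
apply: allpairs_uniq_dep => [|j _|]; rewrite ?iota_uniq //.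
by move=> [j i] [j' i'] _ _ /= [-> ->].
Qed.

Lemma size_boxes la : size (boxes la) = sumn la.
Proof.
rewrite size_allpairs_dep; congr sumn.
by under eq_map do rewrite size_iota; rewrite map_nth_iota0 ?take_size.
Qed.

Lemma size_of_shape la t : uniq t -> of_shape la t -> size t = sumn la.
Proof.
move=> u sh; rewrite -size_boxes; apply/perm_size/uniq_perm => //; first exact: boxes_uniq.
by move=> c; rewrite sh mem_boxes.
Qed.

Lemma partition_pos la m j : is_partition la m -> j < size la -> 0 < nth 0 la j.
Proof. by case/and3P=> _ /(all_nthP 0) h _ /h. Qed.

Lemma partition_sumn la m : is_partition la m -> sumn la = m.
Proof. by case/and3P=> _ _ /eqP. Qed.

Lemma partition_geq la m j j' : is_partition la m -> j <= j' -> nth 0 la j' <= nth 0 la j.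
Proof.
case/and3P=> so _ _ le; case: (ltnP j' (size la)) => h; last by rewrite nth_default.
have tr : transitive geq by move=> x y z /= h1 h2; apply: leq_trans h2 h1.
have rf : reflexive geq by move=> x; apply: leqnn.
exact: (sorted_leq_nth tr rf 0 so j j' (leq_ltn_trans le h) h le).
Qed.

Lemma partition_size la m : is_partition la m -> size la <= m.
Proof.
move=> h; rewrite -(partition_sumn h); have {h} := fun j => @partition_pos _ _ j h.
elim: la => //= x la IH h; have := h 0 isT => /= x0.
by have := IH (fun j hj => h j.+1 hj); lia.
Qed.

(** The boxes determine all row lengths, with default 0; positive parts exclude trailing zeros. *)
Lemma of_shape_inj la la' m m' t : is_partition la m -> is_partition la' m' ->
  of_shape la t -> of_shape la' t -> la = la'.
Proof.
move=> p p' sh sh'.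
have e j : nth 0 la j = nth 0 la' j.
  have h i : (i < nth 0 la j) = (i < nth 0 la' j) by rewrite -(sh (i, j)) -(sh' (i, j)).
  have := h (nth 0 la j); have := h (nth 0 la' j); rewrite !ltnn; clear; lia.
apply: (eq_from_nth (x0 := 0)) => [|j _ //]; apply/eqP; rewrite eqn_leq.
apply/andP; split; rewrite leqNgt; apply/negP => h.
  by have := partition_pos p h; rewrite e nth_default.
by have := partition_pos p' h; rewrite -e nth_default.
Qed.

Lemma shape_exists t : std t -> exists la, is_partition la (size t) /\ of_shape la t.
Proof.
elim/last_ind: t => [|t [i j] IH].
  by exists [::]; split=> // c; rewrite nth_nil ltn0.
rewrite std_rcons => /andP[/IH[la [p sh]]] /and3P[]; rewrite !sh /= => h1 h2 h3.
have ei : i = nth 0 la j.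
  apply/eqP; rewrite eqn_leq [X in _ && X]leqNgt h1 andbT.
  by case: i h2 {h1 h3} => //= i; lia.
have lej : j <= size la.
  case: j h3 {h1 h2 ei} => //= j h; case: (ltnP j (size la)) => // l.
  by rewrite nth_default in h.
(* Row [j] may be new: for [j = size la] this appends a part 1. *)
exists (set_nth 0 la j i.+1); split; last first.
  move=> [x y]; rewrite mem_rcons inE sh /= nth_set_nth /= xpair_eqE.
  by case: (eqVneq y j) => [->|_]; rewrite ?andbF // andbT -ei ltnS [RHS]leq_eqVlt.
apply/and3P; split.
- apply/(sortedP 0) => k; rewrite size_set_nth => hk; rewrite !nth_set_nth /=.
  have g := partition_geq p (leqnSn k).
  case: (eqVneq k.+1 j) => [ej|n1]; last first.
    by rewrite /geq; case: (eqVneq k j) => [ek|_] //; apply: (leq_trans g); rewrite ek -ei.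
  by rewrite -ej (ltn_eqF (ltnSn k)); move: h3; rewrite -ej.
- apply/(all_nthP 0) => k; rewrite size_set_nth nth_set_nth /=.
  case: eqVneq => // nk hk; apply: partition_pos p _.
  by move: nk hk lej; clear; lia.
- rewrite sumn_set_nth0 -ei (partition_sumn p) size_rcons; apply/eqP; lia.
Qed.

Lemma std_nbr_lt t (a c : box) : std t -> c \in t ->
  ((a.1.+1 == c.1) && (a.2 == c.2)) || ((a.1 == c.1) && (a.2.+1 == c.2)) ->
  a \in t /\ index a t < index c t.
Proof.
move=> st ct h; have I := std_ideal st.
have at_ : a \in t by apply: I ct _ _; move: h; clear; lia.
split=> //; rewrite -in_take //.
have : std (take (index c t).+1 t) by apply: std_take.
rewrite (take_nth (0, 0)) ?index_mem // nth_index // std_rcons => /andP[_ /and3P[_ h1 h2]].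
case: a c h h1 h2 {ct at_} => i j [x y] /= /orP[] /andP[/eqP <- /eqP <-] /=.
  by move=> /= ->.
by move=> _ /= ->.
Qed.

(** Increase along rows and columns puts the left and lower neighbours of a box in the prefix before
    it, which is addability. *)
Lemma std_of_nbr_lt t : uniq t ->
  (forall i j, (i.+1, j) \in t -> (i, j) \in t /\ index (i, j) t < index (i.+1, j) t) ->
  (forall i j, (i, j.+1) \in t -> (i, j) \in t /\ index (i, j) t < index (i, j.+1) t) ->
  std t.
Proof.
move=> u h1 h2; suff h k : k <= size t -> std (take k t) by rewrite -(take_size t) h.
elim: k => [|k IH] hk; first by rewrite take0.
rewrite (take_nth (0, 0)) // std_rcons IH /=; last by apply: ltnW.
have := mem_nth (0, 0) hk; have := index_uniq (0, 0) hk u.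
case: (nth _ _ _) => i j ek ijt; rewrite /addable in_take // ek ltnn /=.
apply/andP; split.
  by case: i ijt ek => //= i /h1[ij lt] <-; rewrite in_take.
by case: j ijt ek => //= j /h2[ij lt] <-; rewrite in_take.
Qed.

(** * Tableaux as functions and as lists of boxes *)

Section Rep.
Variable (la : seq nat) (m : nat).
Hypothesis pla : is_partition la m.
Let N := sumn la.

(* t lists the boxes of T in the order of their entries; [cell] and [ent] count
   columns and rows from 1. *)
Definition rep (T : tab la) (t : seq box) : Prop :=
  [/\ uniq t, of_shape la t,
      forall c : 'I_N.+1 * 'I_N.+1, ~~ cell la c.1 c.2 -> T c = ord0 &
      forall c : box, c \in t -> ent T c.1.+1 c.2.+1 = (index c t).+1].

Lemma cell_box (c : box) : cell la c.1.+1 c.2.+1 = (c.1 < nth 0 la c.2).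
Proof. by []. Qed.

Lemma box_bound (c : box) : c.1 < nth 0 la c.2 -> (c.1.+1 < N.+1) && (c.2.+1 < N.+1).
Proof.
move=> h; have h2 : c.2 < size la.
  by case: (ltnP c.2 (size la)) => // l; rewrite nth_default in h.
have : nth 0 la c.2 <= N.
  rewrite /N -(cat_take_drop c.2 la) sumn_cat (drop_nth 0) //= nth_cat.
  rewrite size_takel; last exact: ltnW.
  by rewrite ltnn subnn /=; clear; lia.
have := partition_size pla; rewrite -(partition_sumn pla) -/N; move: h h2; clear; lia.
Qed.

Lemma cell_inord (c : 'I_N.+1 * 'I_N.+1) : cell la c.1 c.2 ->
  exists b : box, [/\ b.1 < nth 0 la b.2, val c.1 = b.1.+1, val c.2 = b.2.+1 &
    c = (inord b.1.+1, inord b.2.+1)].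
Proof.
case: c => x y /and3P[x0 y0 h]; exists (x.-1, y.-1); rewrite /= in x0 y0 h *.
rewrite !prednK // !inord_val; split=> //; lia.
Qed.

Lemma rep_size T t : rep T t -> size t = N.
Proof. by case=> u sh _ _; apply: size_of_shape. Qed.

Lemma rep_fun T t t' : rep T t -> rep T t' -> t = t'.
Proof.
move=> r r'; have [u sh _ e] := r; have [u' sh' _ e'] := r'.
apply: (eq_from_nth (x0 := (0, 0))) => [|k hk]; first by rewrite (rep_size r) (rep_size r').
have ct := mem_nth (0, 0) hk; have ct' := ct; rewrite sh -sh' in ct'.
by have := e _ ct; rewrite e' // index_uniq // => -[ek]; rewrite -[in RHS]ek nth_index.
Qed.

Lemma rep_inj T T' t : rep T t -> rep T' t -> T = T'.
Proof.
move=> [u sh z e] [_ _ z' e']; apply/ffunP => c.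
case: (boolP (cell la c.1 c.2)) => h; last by rewrite z ?z'.
have [b [hb _ _ ->]] := cell_inord h.
by apply/val_inj; have := e b; rewrite -e' sh //; apply.
Qed.

(** Cut the reading word before the diagonal [d'] of [c']: the entry of [c] occurs in the first
    part, that of [c'] does not. *)
Lemma rep_index_lt T t (c c' : box) : rep T t -> c \in t -> c' \in t -> clt c c' ->
  index (index c t).+1 (rw T) < index (index c' t).+1 (rw T).
Proof.
move=> [u sh _ e] ct ct' lt; set k := (index c t).+1; set k' := (index c' t).+1.
have [hc hc'] : c.1 < nth 0 la c.2 /\ c'.1 < nth 0 la c'.2 by rewrite -!sh.
pose K := N.+1; pose d' := c'.1 + K - c'.2.
have [b1 b2] := andP (box_bound hc); have [b1' b2'] := andP (box_bound hc').
rewrite /rw -/N -/K; set B := fun d => _.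
have iotaE : iota 0 (2 * K) = iota 0 d' ++ iota d' (2 * K - d').
  rewrite -iotaD; congr iota; rewrite /d' /K; move: b1' b2'; clear; lia.
have memB d x : x \in [seq ent T p.1 p.2 | p <- [seq (i, j) | j <- iota 1 K, i <- iota 1 K]
    & cell la p.1 p.2 && (p.1 + K == d + p.2)] ->
  exists b : box, [/\ b \in t, x = (index b t).+1 & b.1 + K = d + b.2].
  case/mapP=> -[i j]; rewrite mem_filter => /andP[/andP[/and3P[i0 j0 h] /eqP h2] _] ->.
  rewrite /= in i0 j0 h h2.
  exists (i.-1, j.-1); have bt : (i.-1, j.-1) \in t by rewrite sh /=; move: i0 h; clear; lia.
  split=> //=; last by move: i0 j0 h2; clear; lia.
  by rewrite -e //= !prednK.
rewrite iotaE map_cat flatten_cat !index_cat.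
have kin : k \in flatten (map B (iota 0 d')).
  apply/flattenP; exists (B (c.1 + K - c.2)).
    apply: map_f; rewrite mem_iota /=; move: lt b2 b2'; rewrite /d' /clt /K; clear; lia.
  apply/mapP; exists (c.1.+1, c.2.+1); last by rewrite /= e.
  rewrite mem_filter; apply/andP; split.
    by rewrite cell_box hc; move: b2; rewrite /K /=; clear; lia.
  apply/allpairsPdep; exists c.2.+1, c.1.+1; rewrite !mem_iota.
  by split=> //; move: b1 b2; rewrite /K; clear; lia.
rewrite kin; case: ifP => h; last first.
  by apply: leq_trans (leq_addr _ _); rewrite index_mem.
have /flattenP[x /mapP[d hd ->] /memB[b [bt ekb hb]]] := h.
have ebc : b = c'.
  by case: ekb => ekb; rewrite -(nth_index (0, 0) bt) -(nth_index (0, 0) ct') ekb.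
by move: hd hb; rewrite mem_iota ebc /d' /K; clear; lia.
Qed.
End Rep.

Section Rep.
Variable (la : seq nat) (m : nat).
Hypothesis pla : is_partition la m.
Let N := sumn la.

Lemma ent_box (T : tab la) (c : box) :
  ent T c.1.+1 c.2.+1 = val (T (inord c.1.+1, inord c.2.+1)).
Proof. by []. Qed.

Lemma rep_exists (T : SYT la) : exists t, rep (val T) t.
Proof.
case: T => T /=; rewrite /syt_pred -/N => /and5P[/forallP z /forallP pos_ /forallP inj /forallP sur _].
have ex (k : 'I_N.+1) : exists c : 'I_N.+1 * 'I_N.+1, 0 < k -> cell la c.1 c.2 /\ T c = k.
  (* The value 0 is not an entry and receives a dummy box. *)
  have := sur k; case: (posnP k) => [k0 _|k0 /=]; first by exists (ord0, ord0).
  by case/existsP=> c /andP[h /eqP e]; exists c.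
have [f hf] := fin_all_exists ex.
have [g gD] : exists g : nat -> box,
    forall k, g k = ((val (f (inord k)).1).-1, (val (f (inord k)).2).-1) by eexists.
have gP k : 0 < k <= N -> (g k).1 < nth 0 la (g k).2 /\ ent T (g k).1.+1 (g k).2.+1 = k.
  move=> hk; have vk : val (inord k : 'I_N.+1) = k by rewrite /= inordK //; lia.
  have [|h e] := hf (inord k); first by rewrite vk; case/andP: hk.
  have [b [hb e1 e2 ef]] := cell_inord h.
  rewrite gD e1 e2 /=; split=> //; rewrite (ent_box T b) -ef e /=.
  by rewrite inordK //; lia.
have gE k (c : box) : 0 < k <= N -> c.1 < nth 0 la c.2 -> ent T c.1.+1 c.2.+1 = k -> g k = c.
  move=> hk hc ec; have [hg eg] := gP k hk.
  have [b1 b2] := andP (box_bound pla hc); have [b3 b4] := andP (box_bound pla hg).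
  rewrite -/N in b1 b2 b3 b4.
  have /forallP := inj (inord c.1.+1, inord c.2.+1).
  move=> /(_ (inord (g k).1.+1, inord (g k).2.+1)); rewrite /= !inordK // !cell_box hc hg /=.
  have -> : T (inord c.1.+1, inord c.2.+1) == T (inord (g k).1.+1, inord (g k).2.+1).
    by apply/eqP/val_inj; rewrite -!ent_box ec eg.
  move=> /= /eqP[/(congr1 val) /= + /(congr1 val) /=]; rewrite !inordK //.
  by move=> [e1] [e2]; rewrite [g k]surjective_pairing -e1 -e2 -surjective_pairing.
have entP (c : box) : c.1 < nth 0 la c.2 -> 0 < ent T c.1.+1 c.2.+1 <= N.
  move=> hc; have [b1 b2] := andP (box_bound pla hc); rewrite -/N in b1 b2.
  rewrite ent_box; apply/andP; split; last exact: leq_ord.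
  by have := pos_ (inord c.1.+1, inord c.2.+1); rewrite /= !inordK // cell_box hc.
exists (map g (iota 1 N)); split.
- rewrite map_inj_in_uniq ?iota_uniq // => k k'; rewrite !mem_iota => hk hk' e.
  by rewrite -(proj2 (gP k _)) ?e ?(proj2 (gP k' _)) //; lia.
- move=> c; apply/mapP/idP => [[k]|hc]; first by rewrite mem_iota => hk ->; apply: (proj1 (gP k _)); lia.
  exists (ent T c.1.+1 c.2.+1); first by rewrite mem_iota; have := entP c hc; lia.
  by rewrite (gE _ c) // entP.
- by move=> c hc; apply/eqP; apply: (implyP (z c)).
- move=> c /mapP[k]; rewrite mem_iota => hk ->.
  have hk' : 0 < k <= N by lia.
  rewrite (proj2 (gP k hk')).
  have -> : g k = nth (g 0) (map g (iota 1 N)) k.-1.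
    by rewrite (nth_map 0) ?size_iota ?nth_iota ?add1n ?prednK //; lia.
  rewrite index_uniq ?size_map ?size_iota; try lia.
  rewrite map_inj_in_uniq ?iota_uniq // => i j; rewrite !mem_iota => hi hj e.
  by rewrite -(proj2 (gP i _)) ?e ?(proj2 (gP j _)) //; lia.
Qed.

Lemma rep_std (T : SYT la) t : rep (val T) t -> std t.
Proof.
case: T => T /= sy [u sh z e]; move: sy; rewrite /syt_pred -/N.
case/and5P=> _ _ _ _ /andP[/forallP r1 /forallP r2].
have dn (c : box) : c \in t -> (c.1.+1 < N.+1) && (c.2.+1 < N.+1).
  by rewrite sh => /(box_bound pla).
apply: std_of_nbr_lt u _ _ => i j h.
- have hi : (i, j) \in t by move: h; rewrite !sh /=; apply: ltnW.
  split=> //; have [b1 b2] := andP (dn _ h); have [b3 b4] := andP (dn _ hi).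
  rewrite -ltnS -(e _ h) -(e _ hi) /=.
  have /forallP := r1 (inord i.+1, inord j.+1).
  move=> /(_ (inord i.+2, inord j.+1)); rewrite /= !inordK // !eqxx.
  by rewrite (cell_box _ (i, j)) (cell_box _ (i.+1, j)) -!sh h hi.
- have hi : (i, j) \in t.
    by move: h; rewrite !sh /= => h; apply: leq_trans h (partition_geq pla _).
  split=> //; have [b1 b2] := andP (dn _ h); have [b3 b4] := andP (dn _ hi).
  rewrite -ltnS -(e _ h) -(e _ hi) /=.
  have /forallP := r2 (inord i.+1, inord j.+1).
  move=> /(_ (inord i.+1, inord j.+2)); rewrite /= !inordK // !eqxx.
  by rewrite (cell_box _ (i, j)) (cell_box _ (i, j.+1)) -!sh h hi.
Qed.

Lemma rep_tab t : std t -> of_shape la t -> exists T : SYT la, rep (val T) t.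
Proof.
move=> st sh; have u := std_uniq st; have sz := size_of_shape u sh.
pose T : tab la := [ffun c : 'I_N.+1 * 'I_N.+1 => if cell la c.1 c.2 then inord (index ((val c.1).-1, (val c.2).-1) t).+1
  else ord0].
have TE (c : box) : c \in t -> T (inord c.1.+1, inord c.2.+1) = (index c t).+1 :> nat.
  move=> ct; have hc := ct; rewrite sh in hc.
  have [b1 b2] := andP (box_bound pla hc).
  rewrite ffunE /= !inordK // cell_box hc -surjective_pairing inordK //.
  by rewrite ltnS -sz index_mem.
have eT (b b' : box) : b \in t -> b' \in t -> index b t = index b' t -> b = b'.
  by move=> h h' ee; rewrite -(nth_index (0, 0) h) ee nth_index.
have sT : syt_pred T.
  apply/and5P; split; [| | | |apply/andP; split].
  - by apply/forallP => c; apply/implyP => h; rewrite ffunE (negbTE h).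
  - apply/forallP => c; apply/implyP => /cell_inord[b [hb _ _ ->]].
    by rewrite TE // sh.
  - apply/forallP => c; apply/forallP => c'; apply/implyP.
    move=> /and3P[/cell_inord[b [hb _ _ ->]] /cell_inord[b' [hb' _ _ ->]] /eqP/(congr1 val)].
    by rewrite /= !TE ?sh // => -[/eT ->]; rewrite ?sh.
  - apply/forallP => k; apply/implyP => k0; apply/existsP.
    have hk : k.-1 < size t by rewrite sz; have := ltn_ord k; lia.
    have ct := mem_nth (0, 0) hk; set c := nth _ _ _ in ct.
    have hc := ct; rewrite sh in hc; have [b1 b2] := andP (box_bound pla hc).
    exists (inord c.1.+1, inord c.2.+1); rewrite /= !inordK // cell_box hc /=.
    by apply/eqP/val_inj; rewrite /= TE // index_uniq // prednK.
  - apply/forallP => c; apply/forallP => c'; apply/implyP.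
    move=> /and4P[/cell_inord[b [hb e1 e2 ec]] /cell_inord[b' [hb' e1' e2' ec']] h1 h2].
    move: h1 h2; rewrite e1 e2 e1' e2' !eqSS => /eqP h1 /eqP h2.
    rewrite ec ec' !TE ?sh // ltnS; apply: (proj2 (std_nbr_lt st _ _)); rewrite ?sh //.
    by rewrite h1 h2 !eqxx.
  - apply/forallP => c; apply/forallP => c'; apply/implyP.
    move=> /and4P[/cell_inord[b [hb e1 e2 ec]] /cell_inord[b' [hb' e1' e2' ec']] h1 h2].
    move: h1 h2; rewrite e1 e2 e1' e2' !eqSS => /eqP h1 /eqP h2.
    rewrite ec ec' !TE ?sh // ltnS; apply: (proj2 (std_nbr_lt st _ _)); rewrite ?sh //.
    by rewrite h1 h2 !eqxx orbT.
exists (exist _ T sT); split=> // c h.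
by rewrite ffunE (negbTE h).
Qed.

Lemma index_nth_cat (s u : seq box) x : uniq (s ++ x :: u) -> index x (s ++ x :: u) = size s.
Proof.
by rewrite cat_uniq index_cat => /and3P[_ /norP[/negbTE -> _] _]; rewrite /= eqxx addn0.
Qed.

Lemma rep_pos (T : tab la) s x u : rep T (s ++ x :: u) ->
  forall y v w, s ++ x :: u = v ++ y :: w -> clt x y -> pos T (size s).+1 < pos T (size v).+1.
Proof.
move=> r y v w e lt; have [un _ _ _] := r; have un' := un; rewrite e in un'.
have xt : x \in s ++ x :: u by rewrite mem_cat inE eqxx orbT.
have yt : y \in s ++ x :: u by rewrite e mem_cat inE eqxx orbT.
have := rep_index_lt pla r xt yt lt.
by rewrite index_nth_cat // [in index y _]e index_nth_cat.
Qed.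

Lemma rep_pos3 (T : tab la) s p q r u : rep T (s ++ [:: p, q, r & u]) -> cmp3 p q r ->
  let P := pos T (size s).+1 in let Q := pos T (size s).+2 in let R := pos T (size s).+3 in
  [/\ (P < Q) = clt p q, (Q < P) = clt q p & (Q < R) = clt q r] /\
  [/\ (R < Q) = clt r q, (P < R) = clt p r & (R < P) = clt r p].
Proof.
move=> h c3 P Q R.
have ep : s ++ [:: p, q, r & u] = s ++ p :: [:: q, r & u] by [].
have eq : s ++ [:: p, q, r & u] = rcons s p ++ q :: [:: r & u] by rewrite cat_rcons.
have er : s ++ [:: p, q, r & u] = rcons (rcons s p) q ++ r :: u by rewrite !cat_rcons.
have hq := h; rewrite eq in hq; have hr := h; rewrite er in hr.
have pq : clt p q -> P < Q by move=> lt; have := rep_pos h eq lt; rewrite !size_rcons.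
have pr : clt p r -> P < R by move=> lt; have := rep_pos h er lt; rewrite !size_rcons.
have qp : clt q p -> Q < P.
  by move=> lt; have := rep_pos hq (etrans (esym eq) ep) lt; rewrite !size_rcons.
have qr : clt q r -> Q < R.
  by move=> lt; have := rep_pos hq (etrans (esym eq) er) lt; rewrite !size_rcons.
have rp : clt r p -> R < P.
  by move=> lt; have := rep_pos hr (etrans (esym er) ep) lt; rewrite !size_rcons.
have rq : clt r q -> R < Q.
  by move=> lt; have := rep_pos hr (etrans (esym er) eq) lt; rewrite !size_rcons.
move: c3 pq pr qp qr rp rq; rewrite /cmp3; clearbody P Q R; clear.
have nl a b : clt a b -> clt b a = false by rewrite /clt; clear; lia.
have gl a b : a < b -> (b < a) = false by clear; lia.
case/and3P=> /orP[] h1 /orP[] h2 /orP[] h3; rewrite h1 h2 h3 !(nl _ _ h1) !(nl _ _ h2) !(nl _ _ h3).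
all: move=> a1 a2 a3 a4 a5 a6; split; split; lia.
Qed.

Lemma rep_sgn (T : SYT la) t i : rep (val T) t -> 0 < i < N -> sg (sigma_syt T) i = sgn t i.
Proof.
move=> r hi; have st := rep_std r; have sz := rep_size r.
rewrite /sg /sigma_syt (nth_map 0) ?size_iota ?nth_iota; try (move: hi; rewrite /N; clear; lia).
rewrite add1n prednK; last by case/andP: hi.
have e := cat_take_drop i.-1 t.
have szt : size (take i.-1 t) = i.-1 by rewrite size_takel // sz; move: hi; clear; lia.
have szd : 1 < size (drop i.-1 t) by rewrite size_drop sz; move: hi; clear; lia.
case: (drop _ _) e szd => [|x [|y u]] // e _; rewrite -e in r st *.
have i0 : i = (size (take i.-1 t)).+1 by rewrite szt prednK //; case/andP: hi.
have c2 : clt x y || clt y x.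
  apply: (@clt_total2 (take i.-1 t)).
  by move: st; rewrite -[x :: y :: u]/([:: x; y] ++ u) catA std_cat => /andP[].
rewrite (sgn_nth _ _ _ i0).
have e2 : take i.-1 t ++ [:: x, y & u] = rcons (take i.-1 t) x ++ y :: u by rewrite cat_rcons.
have r2 := r; rewrite e2 in r2.
have l1 : clt x y -> pos (val T) i < pos (val T) i.+1.
  by move=> lt; have := rep_pos r e2 lt; rewrite size_rcons -i0.
have l2 : clt y x -> pos (val T) i.+1 < pos (val T) i.
  by move=> lt; have := rep_pos r2 (esym e2) lt; rewrite size_rcons -i0.
case: (boolP (clt x y)) c2 => [/l1 -> //|_ /= /l2 lt].
by apply/negbTE; rewrite -leqNgt ltnW.
Qed.

(** The two argument orders are those of the exchanges with [i+1] and with [i-1] in [dual_d]. *)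
Lemma rep_swap (T : tab la) s x y u : rep T (s ++ [:: x, y & u]) ->
  rep (swap_ent T (size s).+1 (size s).+2) (s ++ [:: y, x & u]) /\
  rep (swap_ent T (size s).+2 (size s).+1) (s ++ [:: y, x & u]).
Proof.
move=> r; have [un sh z e] := r.
have sz := rep_size r; rewrite size_cat /= in sz.
have pe : perm_eq (s ++ [:: y, x & u]) (s ++ [:: x, y & u]).
  by rewrite perm_cat2l (perm_catCA [:: y] [:: x]).
have un' : uniq (s ++ [:: y, x & u]) by rewrite (perm_uniq pe).
have [nx ny] : x \notin s /\ y \notin s.
  by move: un; rewrite cat_uniq /= !negb_or => /and3P[_ /and3P[]].
have nxy : (x == y) = false.
  by move: un; rewrite cat_uniq /= !inE !negb_or => /and3P[_ _ /andP[/andP[/negbTE-> _] _]].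
have nyx : (y == x) = false by rewrite eq_sym.
have i1 : index x (s ++ [:: x, y & u]) = size s by apply: index_nth_cat.
have i2 : index y (s ++ [:: x, y & u]) = (size s).+1.
  by rewrite index_cat (negbTE ny) /= nxy eqxx addn1.
have j2 : index y (s ++ [:: y, x & u]) = size s by apply: index_nth_cat.
have j1 : index x (s ++ [:: y, x & u]) = (size s).+1.
  by rewrite index_cat (negbTE nx) /= nyx eqxx addn1.
have jo c : c != x -> c != y -> index c (s ++ [:: y, x & u]) = index c (s ++ [:: x, y & u]).
  by rewrite !index_cat /= ![_ == c]eq_sym => /negbTE -> /negbTE ->.
have sh' : of_shape la (s ++ [:: y, x & u]) by move=> c; rewrite (perm_mem pe) sh.
have ino c : c \in s ++ [:: y, x & u] -> c != x -> c != y ->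
    (ent T c.1.+1 c.2.+1 == (size s).+1 = false) * (ent T c.1.+1 c.2.+1 == (size s).+2 = false).
  rewrite (perm_mem pe) => ct cx cy; rewrite e // !eqSS -i2 -{1}i1.
  have inj d : d \in s ++ [:: x, y & u] -> (index c (s ++ [:: x, y & u]) ==
      index d (s ++ [:: x, y & u])) = (c == d).
    move=> dt; apply/eqP/eqP => [h|-> //].
    by rewrite -(nth_index (0, 0) ct) h nth_index.
  by rewrite !inj ?(negbTE cx) ?(negbTE cy) // mem_cat !inE eqxx ?orbT.
have mx : x \in s ++ [:: x, y & u] by rewrite mem_cat !inE eqxx orbT.
have my : y \in s ++ [:: x, y & u] by rewrite mem_cat !inE eqxx !orbT.
have n12 : ((size s).+2 == (size s).+1) = false by rewrite eqSS; clear; lia.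
have n21 : ((size s).+1 == (size s).+2) = false by rewrite eqSS; clear; lia.
split; split=> //.
- by move=> c h; rewrite ffunE z.
- move=> c ct; rewrite ent_box ffunE -ent_box.
  case: (eqVneq c x) => [->|cx]; first by rewrite e // i1 eqxx j1 /= inordK //; move: sz; clear; lia.
  case: (eqVneq c y) => [->|cy].
    by rewrite e // i2 n12 eqxx j2 /= inordK //; move: sz; clear; lia.
  by rewrite !(ino c ct cx cy) -ent_box jo // e // -(perm_mem pe).
- by move=> c h; rewrite ffunE z.
- move=> c ct; rewrite ent_box ffunE -ent_box.
  case: (eqVneq c x) => [->|cx].
    by rewrite e // i1 n21 eqxx j1 /= inordK //; move: sz; clear; lia.
  case: (eqVneq c y) => [->|cy].
    by rewrite e // i2 eqxx j2 /= inordK //; move: sz; clear; lia.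
  by rewrite !(ino c ct cx cy) -ent_box jo // e // -(perm_mem pe).
Qed.

Lemma rep_dual (T : SYT la) t i : rep (val T) t -> 1 < i < N -> rep (dual_d i (val T)) (dd i t).
Proof.
move=> r hi; have st := rep_std r; rewrite /N -(rep_size r) in hi.
have [s [p [q [x [u [et i0]]]]]] := split3 hi; rewrite et in r st *.
have c3 := std_cmp3 st; rewrite (dd_tri _ i0) /=.
have [] := rep_pos3 r c3; rewrite /dual_d i0 /=.
move: (pos _ (size s).+1) (pos _ (size s).+2) (pos _ (size s).+3) => P Q R [e1 e2 e3] [e4 e5 e6].
have b1 : ((P < Q) && (Q < R)) || ((R < Q) && (Q < P)) = btw p q x.
  by rewrite /btw e1 e2 e3 e4.
rewrite b1; case: ifP => // nb1.
(* Now [i-1] and [i+1] stand on the same side of [i], so [i+1] is the nearer exactly when it stands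
   between. *)
have -> : (absd Q R < absd Q P) = btw p x q.
  move: c3 nb1; rewrite /cmp3 /btw -e1 -e2 -e3 -e4 -e5 -e6 /absd; clear; lia.
have e : s ++ [:: p, q, x & u] = rcons s p ++ [:: q, x & u] by rewrite cat_rcons.
case: ifP => _; first by case: (rep_swap r).
by rewrite e in r; have [] := rep_swap r; rewrite size_rcons cat_rcons.
Qed.

Lemma rep_E (T U : SYT la) t u i : rep (val T) t -> rep (val U) u -> 1 < i < N ->
  E_syt i T U = (t != u) && (u == dd i t).
Proof.
move=> rt ru hi; rewrite /E_syt hi /=.
have st := rep_std rt; have su := rep_std ru.
have hit : 1 < i < size t by rewrite (rep_size rt).
have hiu : 1 < i < size u by rewrite (rep_size ru).
have -> : (T != U) = (t != u).
  congr negb; apply/eqP/eqP => [e|e]; first by apply: rep_fun rt _; rewrite e.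
  by apply/val_inj; apply: rep_inj rt _; rewrite e.
have E1 (X Y : SYT la) x y : rep (val X) x -> rep (val Y) y ->
    (val Y == dual_d i (val X)) = (y == dd i x).
  move=> rx ry; have rd := rep_dual rx hi.
  apply/eqP/eqP => [e|e]; first by apply: rep_fun ry _; rewrite e.
  by apply: rep_inj ry _; rewrite e.
rewrite (E1 _ _ _ _ rt ru) (E1 _ _ _ _ ru rt).
congr andb; apply/orP/idP => [[//|/eqP ->]|->]; last by left.
by rewrite dd_invol.
Qed.

End Rep.

(** * Gluing the components *)

Section Glue.
Variables (n : nat) (V : finType) (sigma : V -> seq bool) (E : nat -> rel V).
Hypothesis G : scg n.+1 n.+1 sigma E.
Hypothesis A : scg_axioms n.+1 n.+1 sigma E.

Definition labels (C : {set V}) (th : V -> seq box) : Prop :=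
  forall u, u \in C -> [/\ std (th u), size (th u) = n.+1,
    forall i, 0 < i <= n -> sg (sigma u) i = sgn (th u) i &
    forall i w, 1 < i < n -> E i u w -> th w = dd i (th u)].

(** Colours below [n] are exactly the moves fixing the entry [n+1], which is all that [rigid]
    requires. *)
Lemma labels_unique (C : {set V}) th th' u :
  (forall i u w, 1 < i < n -> u \in C -> E i u w -> w \in C) ->
  labels C th -> labels C th' -> u \in C -> th u = th' u.
Proof.
move=> cl L L' uC.
pose R t t' := exists x, [/\ x \in C, t = th x & t' = th' x].
apply: (@rigid R n.+1); last by exists u.
- by move=> t t' [x [xC -> ->]]; have [? ? _ _] := L x xC; have [? ? _ _] := L' x xC.
- move=> t t' j [x [xC -> ->]] hj; have [_ _ h _] := L x xC; have [_ _ h' _] := L' x xC.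
  by rewrite -h // -h'.
- move=> t t' i [x [xC -> ->]] i1 i2.
  have [st sz h d] := L x xC; have [st' sz' h' d'] := L' x xC.
  have hi : 1 < i < n by rewrite i1.
  have [hs hs1 hs2 hs3] : [/\ 1 < i < n.+1, 0 < i.-1 <= n, 0 < i <= n & i < n.+1].
    by move: hi; clear; split; lia.
  case: (eqVneq (sg (sigma x) i.-1) (sg (sigma x) i)) => e.
    have -> : dd i (th x) = th x by apply: dd_id; rewrite ?sz // -!h.
    have -> : dd i (th' x) = th' x by apply: dd_id; rewrite ?sz' // -!h'.
    by exists x.
  have [w ew] : exists w, E i x w.
    case: A => /(_ x i hs hs3) [[ex _] _] _ _ _ _; apply: ex.
    by case: (sg _ i.-1) e; case: (sg _ i).
  exists w; split; [exact: cl ew | by rewrite -(d i w) | by rewrite -(d' i w)].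
Qed.

Local Notation comp := (ccomp n (restr_E n E)).

Lemma comp_closed v i u w : 1 < i < n -> u \in comp v -> E i u w -> w \in comp v.
Proof.
move=> hi; rewrite !inE => vu uw; apply: connect_trans vu _; apply: connect1.
have lt : i < n by case/andP: hi.
by apply/existsP; exists (Ordinal lt); rewrite /restr_E /= uw hi !andbT; case/andP: hi.
Qed.

Lemma comp_self v : v \in comp v.
Proof. by rewrite !inE connect0. Qed.

Lemma comp_sub i v w : 1 < i < n -> E i v w -> {subset comp v <= comp w}.
Proof.
move=> hi vw x; rewrite !inE => vx; apply: connect_trans vx.
have wv : E i w v by rewrite (E_sym G) //; move: hi; clear; lia.
by have := comp_closed hi (comp_self w) wv; rewrite inE.
Qed.

(** The isomorphism supplies tableaux of size [n]; the entry [n+1] goes into the box of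
    [last_sign_addable], untouched by colours below [n]. *)
Lemma component_labels v :
  (exists mu : seq nat, is_partition mu n /\ exists phi : V -> SYT mu,
     iso_on n (ccomp n (restr_E n E) v) (restr_sigma n sigma) (restr_E n E)
       (@sigma_syt mu) (@E_syt mu) phi) ->
  exists th, labels (comp v) th.
Proof.
case=> mu [pmu [phi [[m1 m2] inj _]]]; have sumN := partition_sumn pmu.
have [cs csP] := fin_all_exists (rep_exists pmu).
pose theta u := cs (phi u).
have th_std u : std (theta u) by exact: (rep_std pmu (csP _)).
have th_size u : size (theta u) = n by rewrite (rep_size (csP _)) sumN.
have [||||||||a aP] := @last_sign_addable n V sigma E A (ccomp n (restr_E n E) v) theta _ _ _ _ _ _ _ v.
- by move=> i u w; apply: comp_closed.
- by [].
- by [].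
- move=> u i uC hi; rewrite -(rep_sgn pmu (csP (phi u))) ?sumN // m1 // /restr_sigma /sg.
  by rewrite nth_take //; move: hi; clear; lia.
- move=> i u w hi uC uw.
  have wC := comp_closed hi uC uw.
  have := m2 i u w hi uC wC; rewrite /restr_E hi uw => /(_ isT).
  by rewrite (rep_E pmu (csP _) (csP _)) ?sumN // => /andP[_ /eqP].
- move=> u w uC wC e; apply: inj => //; apply/val_inj.
  by apply: rep_inj (csP _) _; rewrite -/(theta u) e.
- by move=> u w _ _ x; have [_ -> _ _] := csP (phi u); have [_ -> _ _] := csP (phi w).
- exact: comp_self.
exists (fun u => rcons (theta u) a) => u uC; have [au su] := aP u uC.
split.
- by rewrite std_rcons th_std.
- by rewrite size_rcons th_size.
- move=> i /andP[i0]; rewrite leq_eqVlt => /orP[/eqP ei|lt]; last first.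
    rewrite -cats1 sgn_cat ?th_size // -(rep_sgn pmu (csP (phi u))) ?sumN ?i0 //.
    by rewrite m1 // /restr_sigma /sg nth_take //; move: i0 lt; clear; lia.
  rewrite ei in i0 *; rewrite su // /sgn !nth_rcons th_size ltnn eqxx.
  by rewrite prednK // leqnn.
- move=> i w hi uw; have wC := comp_closed hi uC uw.
  rewrite -!cats1 dd_cat ?th_size //; congr cat.
  have := m2 i u w hi uC wC; rewrite /restr_E hi uw => /(_ isT).
  by rewrite (rep_E pmu (csP _) (csP _)) ?sumN // => /andP[_ /eqP].
Qed.

Lemma labels_exist :
  (forall v, exists th, labels (comp v) th) ->
  exists psi, labels [set: V] psi /\
    forall i u w, 1 < i < n.+1 -> E i u w -> psi w = dd i (psi u).
Proof.
move=> ex; have [th thP] := fin_all_exists ex.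
(* Each vertex uses the labelling chosen for its own component; [labels_unique] makes these choices
   agree along edges. *)
pose psi v := th v v.
have good v := thP v v (comp_self v).
have psi_dd i u w : 1 < i < n -> E i u w -> psi w = dd i (psi u).
  move=> hi uw; have [_ _ _ /(_ i w hi uw) <-] := good u.
  apply: (@labels_unique (comp u) (th w) (th u)); last exact: comp_closed hi (comp_self u) uw.
  - by move=> j x y; apply: comp_closed.
  - by move=> x xC; apply: (thP w); apply: comp_sub uw _ xC.
  - exact: thP.
exists psi; split.
  move=> u _; have [h1 h2 h3 _] := good u; split=> // i w hi; exact: psi_dd.
move=> i u w /andP[i1]; rewrite ltnS leq_eqVlt => /orP[/eqP ei|lt] uw; last first.
  by apply: psi_dd uw; rewrite i1.
rewrite ei in i1 uw *; apply: (edge_dd G A) => //.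
- by move=> v; case: (good v).
- by move=> v; case: (good v).
- by move=> v j hj; case: (good v) => _ _ /(_ j hj).
Qed.

End Glue.

(** * From the labelling to the morphism and its unique shape *)

Theorem theorem3p10 (n : nat) (V : finType) (sigma : V -> seq bool)
    (E : nat -> rel V) :
  scg n.+1 n.+1 sigma E ->
  scg_axioms n.+1 n.+1 sigma E ->
  connected_scg n.+1 E ->
  (forall v : V, exists mu : seq nat, is_partition mu n /\
     exists phi : V -> SYT mu,
       iso_on n (ccomp n (restr_E n E) v) (restr_sigma n sigma) (restr_E n E)
         (@sigma_syt mu) (@E_syt mu) phi) ->
  exists! la : seq nat, is_partition la n.+1 /\
     exists phi : V -> SYT la,
       morph_on n.+1 [set: V] sigma E (@sigma_syt la) (@E_syt la) phi.
Proof.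
move=> G A [[v0 _] conn] iso.
have [psi [psiP psi_dd]] :=
  labels_exist G A (fun v => component_labels A (iso v)).
have st v : std (psi v) by case: (psiP v (in_setT v)).
have sz v : size (psi v) = n.+1 by case: (psiP v (in_setT v)).
have sgnP v i : 0 < i <= n -> sg (sigma v) i = sgn (psi v) i by case: (psiP v (in_setT v)) => _ _ /(_ i).
(* Every move permutes the boxes, so the shape is constant along paths. *)
have shapes v : psi v =i psi v0.
  have := conn v0 v; case/connectP=> p; elim: p v0 => [|x p IH] u /=; first by move=> _ ->.
  case/andP=> /existsP[i /andP[i1 ux]] px ev y.
  by rewrite (IH x px ev) (psi_dd i u x) ?mem_dd // i1 ltn_ord.
have [la [pla shla]] := shape_exists (st v0); rewrite sz in pla.
have sumN := partition_sumn pla.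
exists la; split.
  split=> //.
  have ex v : exists T : SYT la, rep (val T) (psi v).
    by apply: (rep_tab pla) => // c; rewrite shapes.
  have [phi phiP] := fin_all_exists ex; exists phi; split.
    move=> v _; have szs : size (sigma v) = n by case: G => /(_ v).
    apply: (@eq_from_nth _ false) => [|i].
      by rewrite size_map size_iota sumN szs.
    rewrite size_map size_iota sumN /= => hi.
    have := sgnP v i.+1 hi; rewrite -(rep_sgn pla (phiP v)) ?sumN //.
  move=> i u v hi _ _ uv.
  rewrite (rep_E pla (phiP u) (phiP v)) ?sumN // (psi_dd i u v) // eqxx andbT.
  (* The two tableaux differ because the edge flips the sign [i]. *)
  rewrite -(psi_dd i u v) //; apply/eqP => e.
  have [_ h] := edge_flip A sgnP hi uv.
  by move: h; rewrite e; case: sgn.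
(* Any morphism to a standard graph also labels [V]; uniqueness of labels fixes its tableau at [v0],
   hence its shape. *)
move=> la' [pla' [phi [m1 m2]]]; have sumN' := partition_sumn pla'.
have [cs csP] := fin_all_exists (rep_exists pla').
have lab : labels n sigma E [set: V] (fun v => cs (phi v)).
  move=> u _; split.
  - exact: (rep_std pla' (csP _)).
  - by rewrite (rep_size (csP _)) sumN'.
  - by move=> i hi; rewrite -(rep_sgn pla' (csP _)) ?sumN' ?m1 ?inE.
  - move=> i w hi uw; have hi' : 1 < i < n.+1 by move: hi; clear; lia.
    have := m2 i u w hi' (in_setT _) (in_setT _) uw.
    by rewrite (rep_E pla' (csP _) (csP _)) ?sumN' // => /andP[_ /eqP].
have e : psi v0 = cs (phi v0) by apply: (labels_unique A _ psiP lab).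
have [_ sh _ _] := csP (phi v0); rewrite -e in sh.
exact: of_shape_inj pla pla' shla sh.
Qed.
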